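(* For $n\ge 1$ let $\ell_n$ be the number of level three cheesy polyominoes (on the hexagonal tiling, counted up to translation) having exactly $n$ cells. Then there exist real constants $\kappa$ and $\lambda$, with decimal expansions $\kappa=0.108269\ldots$ and $\lambda=4.288630\ldots$ (i.e. $0.108269\le\kappa<0.108270$ and $4.288630\le\lambda<4.288631$), such that $$\ell_n\sim \kappa\,\lambda^n\qquad (n\to\infty),$$ i.e. $\lim_{n\to\infty} \ell_n/(\kappa\lambda^n)=1$.
   Context: Consider the regular hexagonal tiling of the Euclidean plane, oriented so that every hexagonal tile has two horizontal edges; tiles are called cells. A (hexagonal-celled) polyomino is a union of finitely many (at least one) cells whose interior is connected (for unions of hexagonal cells, this is equivalent to the union being connected). Two polyominoes are considered equal if and only if one is the image of the other under a translation. The cells of a polyomino $P$ are partitioned according to their horizontal projection (cells with the same projection onto the horizontal axis lie in the same block); each block is a column of $P$. Cells of the tiling with the same horizontal projection are stacked vertically, consecutive ones sharing a horizontal edge. A column need not be a connected set; its connected components are its maximal runs of vertically consecutive cells. If a column has two connected components, the gap (hole) between them is the set of cells of the tiling lying in that vertical stack strictly between the two components. Columns are ordered from left to right; the first column is the leftmost one, and two columns are adjacent if they are consecutive in this order. A polyomino $P$ is rightward-semi-directed if the first (leftmost) column of $P$ has no gap (i.e. is connected) and, in every pair of adjacent columns of $P$, every connected component of the right column has at least one edge in common with the left column. For an integer $m\ge 1$, a polyomino $P$ is a level $m$ cheesy polyomino if: (i) $P$ is rightward-semi-directed; (ii) every column of $P$ has at most two connected components; (iii) if a column of $P$ has two connected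 components, then the gap between the components consists of at most $m$ cells. *)

(* Defs.v *)
From mathcomp Require Import all_boot all_order all_algebra.
From mathcomp Require Import finmap.
From mathcomp Require Import all_classical all_reals all_analysis.

Set Implicit Arguments.
Unset Strict Implicit.
Unset Printing Implicit Defensive.

Import Order.TTheory GRing.Theory Num.Theory.
Import numFieldNormedType.Exports.

Local Open Scope classical_set_scope.
Local Open Scope fset_scope.
Local Open Scope ring_scope.

(* The cells of the hexagonal tiling (each cell having two horizontal edges)
   in axial coordinates: when the horizontal edges have length 1, the cell
   (i, j) is the one centred at ((3/2) i, sqrt 3 * (j + i/2)).  Thus i indexes
   the vertical stacks from left to right, and j increases upwards inside a
   stack. *)
Definition cell : Type := (int * int)%type.

(* The six vectors from a cell to the cells sharing an edge with it. *)
Definition hex_directions : seq cell :=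
  [:: (0, 1); (0, -1); (1, 0); (1, -1); (-1, 0); (-1, 1)].

Definition share_edge : rel cell :=
  fun c d => ((d.1 - c.1, d.2 - c.2) : cell) \in hex_directions.

Definition connected_cells (A : {fset cell}) : Prop :=
  forall c d, c \in A -> d \in A ->
  exists p : seq cell,
    [/\ path share_edge c p, {subset p <= A} & last c p = d].

(* A polyomino is represented by its set of cells; two cells meet only along a
   common edge or not at all (three cells meet at each vertex, pairwise along
   edges), so connectedness of the union, or of its interior, is connectedness
   of the edge-sharing graph. *)
Definition polyomino (P : {fset cell}) : Prop :=
  P != fset0 /\ connected_cells P.

Definition column (P : {fset cell}) (i : int) : {fset cell} :=
  [fset c in P | c.1 == i].

Definition is_column_index (P : {fset cell}) (i : int) : Prop :=
  column P i != fset0.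

Definition first_column (P : {fset cell}) (i : int) : Prop :=
  is_column_index P i /\ forall k, is_column_index P k -> i <= k.

Definition adjacent_columns (P : {fset cell}) (i k : int) : Prop :=
  [/\ is_column_index P i, is_column_index P k, i < k &
      forall j, is_column_index P j -> ~~ (i < j < k)].

Definition is_component (A K : {fset cell}) : Prop :=
  [/\ K != fset0, K `<=` A, connected_cells K &
      forall K' : {fset cell},
        K `<=` K' -> K' `<=` A -> connected_cells K' -> K' = K].

Definition components (A : {fset cell}) : {fset {fset cell}} :=
  [fset K in fpowerset A | `[< is_component A K >]].

Definition rightward_semi_directed (P : {fset cell}) : Prop :=
  (forall i, first_column P i -> connected_cells (column P i)) /\
  (forall i k, adjacent_columns P i k ->
     forall K, K \in components (column P k) ->
     exists c d, [/\ c \in K, d \in column P i & share_edge c d]).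

(* The cells of the stack i strictly between K and L, whichever is the lower. *)
Definition gap (i : int) (K L : {fset cell}) : set cell :=
  [set c | c.1 = i /\ forall a b, a \in K -> b \in L ->
             (a.2 < c.2 < b.2) || (b.2 < c.2 < a.2)].

Definition cheesy (m : nat) (P : {fset cell}) : Prop :=
  [/\ polyomino P,
      rightward_semi_directed P,
      forall i, (#|` components (column P i)| <= 2)%N &
      forall i K L, K \in components (column P i) ->
        L \in components (column P i) -> K != L ->
        (gap i K L #<= `I_m)%card].

Definition translate (v : cell) (P : {fset cell}) : {fset cell} :=
  [fset ((c.1 + v.1, c.2 + v.2) : cell) | c in P].

Definition translation_class (P : {fset cell}) : set {fset cell} :=
  [set Q | exists v, Q = translate v P].

Definition cheesy_classes (m n : nat) : set (set {fset cell}) :=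
  [set translation_class P | P in [set P | cheesy m P /\ #|` P| = n]].

(* fset_set returns the empty set on an infinite argument; cheesy_classes m n
   is finite. *)
Definition cheesy_count (m n : nat) : nat :=
  #|` fset_set (cheesy_classes m n)|.

(* Main.v *)
(** Idea. The columns of a cheesy polyomino are glued from left to right. A
    column is a shape (a, g, b): a run of a cells, a gap of g cells and a run
    of b cells above it (g = b = 0 for a connected column). To a column of
    total height w one can attach a run of k cells in w + k ways, and a column
    with a gap of h cells in w - h ways, up to corrections that only see the
    gap and runs of length at most 2. The number of extensions of a polyomino
    is therefore an affine function of the lengths of the runs of its last
    column once these are at least 3, and a finite vector of sums of such
    numbers evolves linearly with the number of cells. Hence the counting
    sequence l satisfies a linear recurrence with integer coefficients. Let x
    be the smallest positive root of its reversed characteristic polynomial.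
    Dividing out the root x leaves a recurrence with constant right-hand side
    for l_n x^n; after multiplication by a suitable polynomial its leading
    coefficient dominates the sum of the others, so l_n x^n converges, and its
    limit is a quotient of two polynomials evaluated at x. The numerical facts
    are certified by interval arithmetic over binary integers. *)

Require Import Defs.
From Stdlib Require Import BinIntDef.
From mathcomp Require Import all_boot all_order all_algebra.
From mathcomp Require Import finmap.
From mathcomp Require Import all_classical all_reals all_analysis.
From mathcomp Require Import ring lra zify ssrZ.
Import Order.TTheory GRing.Theory Num.Theory.
Import numFieldNormedType.Exports.
Local Open Scope classical_set_scope.
Local Open Scope fset_scope.
Local Open Scope ring_scope.

(** * Recurrences with a dominant leading coefficient *)

(** Solving for the term of highest index bounds it by t = s / p 0 < 1 times a common bound on the K
    + 1 preceding terms, so the bound gains a factor t with every block of K + 1 indices. *)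
Lemma dominated_recurrence_cvg0 (R : realType) (K : nat) (p b : nat -> R) :
  \sum_(1 <= k < K.+2) `|p k| < p 0%N ->
  (forall n, \sum_(k < K.+2) p k * b (n + (K.+1 - k))%N = 0) ->
  b n @[n --> \oo] --> (0 : R).
Proof.
move=> hp hb.
set s := \sum_(1 <= k < K.+2) `|p k| in hp.
have s0 : 0 <= s by apply: sumr_ge0 => k _; exact: normr_ge0.
have p0 : 0 < p 0%N by exact: le_lt_trans hp.
set t := s / p 0%N.
have t0 : 0 <= t by rewrite divr_ge0 // ltW.
have t1 : t < 1 by rewrite ltr_pdivrMr // mul1r.
set C := \sum_(i < K.+1) `|b i|.
have C0 : 0 <= C by apply: sumr_ge0.
have bound n : `|b n| <= C * t ^+ (n %/ K.+1).
  elim/ltn_ind: n => n IH.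
  have [nK|Kn] := ltnP n K.+1.
    rewrite divn_small // expr0 mulr1 /C (bigD1 (Ordinal nK)) //= lerDl.
    by apply: sumr_ge0.
  have [m nm] : exists m, n = (m + K.+1)%N by exists (n - K.+1)%N; rewrite subnK.
  have /eqP := hb m; rewrite big_ord_recl /= subn0 -nm addr_eq0 => /eqP e.
  have : p 0%N * `|b n| <= s * (C * t ^+ (m %/ K.+1)).
    rewrite -[X in X * `|b n|](ger0_norm (ltW p0)) -normrM e normrN.
    apply: (le_trans (ler_norm_sum _ _ _)).
    rewrite /s big_add1 big_mkord mulr_suml; apply: ler_sum => i _.
    rewrite normrM /bump /= add1n; apply: ler_wpM2l => //.
    (* All terms on the right have index at least m, and powers of t decrease. *)
    apply: (le_trans (IH _ _)); first by rewrite nm; lia.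
    apply: ler_wpM2l => //; apply: ler_wiXn2l; rewrite // ?ltW //.
    by apply: leq_div2r; lia.
  have -> : (n %/ K.+1 = (m %/ K.+1).+1)%N by rewrite nm divnDr // divnn addn1.
  rewrite -ler_pdivlMl // => /le_trans; apply.
  by rewrite exprS /t le_eqVlt; apply/orP; left; apply/eqP; ring.
apply/cvgrPdist_lt => e e0.
have /cvgrPdist_lt /(_ e e0) [N _ hN] : C * t ^+ n @[n --> \oo] --> (0 : R).
  by apply: cvg_geometric; rewrite ger0_norm.
exists (N * K.+1)%N => // n /= hn.
rewrite sub0r normrN; apply: le_lt_trans (bound n) _.
have /= := hN (n %/ K.+1)%N; rewrite leq_divRL // => /(_ hn).
rewrite sub0r normrN ger0_norm // mulr_ge0 //; exact: exprn_ge0.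
Qed.

(** The candidate limit is the constant solution; subtracting it leaves the homogeneous recurrence.
    Domination also makes the sum of the coefficients positive. *)
Lemma dominated_recurrence_cvg (R : realType) (K : nat) (p a : nat -> R) (c : R) :
  \sum_(1 <= k < K.+2) `|p k| < p 0%N ->
  (forall n, \sum_(k < K.+2) p k * a (n + (K.+1 - k))%N = c) ->
  a n @[n --> \oo] --> c / \sum_(k < K.+2) p k.
Proof.
move=> hp ha; set S := \sum_(k < K.+2) p k.
have S0 : S != 0.
  rewrite gt_eqF // /S -(big_mkord xpredT p) big_ltn //.
  rewrite -ltrBlDl sub0r ltrNl.
  apply: le_lt_trans hp; rewrite -sumrN; apply: ler_sum => k _.
  by rewrite -normrN; exact: ler_norm.
apply/subr_cvg0; apply: dominated_recurrence_cvg0 hp _ => n.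
under eq_bigr do rewrite mulrBr.
by rewrite sumrB ha -mulr_suml -/S mulrC divfK // subrr.
Qed.

(* Summation by parts: [q] vanishes at 1, and its partial sums are the
   coefficients of its quotient by the corresponding linear factor. *)
Lemma linear_recurrence_invariant (R : comRingType) (K : nat) (q a : nat -> R) :
  \sum_(k < K.+3) q k = 0 ->
  (forall n, \sum_(k < K.+3) q k * a (n + (K.+2 - k))%N = 0) ->
  forall n, \sum_(k < K.+2) (\sum_(i < k.+1) q i) * a (n + (K.+1 - k))%N =
            \sum_(k < K.+2) (\sum_(i < k.+1) q i) * a (K.+1 - k)%N.
Proof.
move=> hq ha; elim=> [//|n <-].
pose P k := \sum_(i < k) q i.
have PK : P K.+3 = 0 by [].
have PS k : P k.+1 = P k + q k by rewrite /P big_ord_recr.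
apply/eqP; rewrite -subr_eq0; apply/eqP; rewrite -[RHS](ha n).
rewrite -[LHS]/(\sum_(k < K.+2) P k.+1 * a (n.+1 + (K.+1 - k))%N -
  \sum_(k < K.+2) P k.+1 * a (n + (K.+1 - k))%N).
(* Both sums extend to K + 3 terms because [P] vanishes at both ends, 0 and K + 3; their termwise
   difference is then the recurrence itself. *)
have -> : \sum_(k < K.+2) P k.+1 * a (n.+1 + (K.+1 - k))%N =
  \sum_(k < K.+3) P k.+1 * a (n + (K.+2 - k))%N.
  rewrite [RHS]big_ord_recr /= PK mul0r addr0.
  by apply: eq_bigr => i _; congr (_ * a _); have := ltn_ord i; lia.
have -> : \sum_(k < K.+2) P k.+1 * a (n + (K.+1 - k))%N =
  \sum_(k < K.+3) P k * a (n + (K.+2 - k))%N.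
  rewrite [RHS]big_ord_recl [P ord0]big_ord0 mul0r add0r.
  by apply: eq_bigr => i _; congr (_ * a _); rewrite /= /bump; lia.
rewrite -sumrB; apply: eq_bigr => i _; rewrite PS -mulrBl; congr (_ * _); ring.
Qed.

(** * Interval evaluation of integer polynomials *)

Notation Z := BinNums.Z.

(* The computed functions below use the operations of [BinInt.Z] directly: those
   of the ring structure on [Z] are much slower to reduce. *)
Definition zr (R : pzRingType) (z : Z) : R := (int_of_Z z)%:~R.

Section ZR.
Variable R : realDomainType.
Lemma zrD (x y : Z) : zr R (x + y) = zr R x + zr R y.
Proof. by rewrite /zr rmorphD rmorphD. Qed.
Lemma zrM (x y : Z) : zr R (x * y) = zr R x * zr R y.
Proof. by rewrite /zr rmorphM rmorphM. Qed.
Lemma zr0 : zr R 0 = 0. Proof. by []. Qed.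
Lemma zr1 : zr R 1 = 1. Proof. by []. Qed.
Lemma zrN (x : Z) : zr R (- x) = - zr R x.
Proof. by rewrite /zr rmorphN rmorphN. Qed.
Lemma zr_le (x y : Z) : (zr R x <= zr R y) = (x <= y).
Proof. rewrite /zr ler_int; lia. Qed.
Lemma zr_lt (x y : Z) : (zr R x < zr R y) = (x < y).
Proof. rewrite /zr ltr_int; lia. Qed.
Lemma zr_nat (n : nat) : zr R (BinInt.Z.of_nat n) = n%:R.
Proof.
rewrite /zr; have -> : int_of_Z (BinInt.Z.of_nat n) = n%:Z by lia.
by rewrite -pmulrn.
Qed.

Definition ev (l : seq Z) (x : R) := horner_rec (map (zr R) l) x.

Fixpoint ladd (l l' : seq Z) : seq Z :=
  match l, l' with
  | [::], _ => l'
  | _, [::] => l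
  | c :: l, c' :: l' => BinInt.Z.add c c' :: ladd l l'
  end.

Fixpoint lscale (c : Z) (l : seq Z) : seq Z :=
  if l is d :: l then BinInt.Z.mul c d :: lscale c l else [::].

Lemma ev_add l l' x : ev (ladd l l') x = ev l x + ev l' x.
Proof.
elim: l l' => [|c l IH] [|c' l']; rewrite /ev /= ?add0r ?addr0 //.
by have := IH l'; rewrite /ev (zrD c c') => ->; ring.
Qed.

Lemma ev_scale c l x : ev (lscale c l) x = zr R c * ev l x.
Proof.
elim: l => [|d l IH]; rewrite /ev /= ?mulr0 //.
by move: IH; rewrite /ev (zrM c d) => ->; ring.
Qed.

Lemma ev_nseq0 n l x : ev (nseq n 0 ++ l) x = x ^+ n * ev l x.
Proof.
elim: n => [|n IH]; first by rewrite mul1r.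
by move: IH; rewrite /ev /= => ->; rewrite exprS zr0; ring.
Qed.

Lemma ev_cons c l x : ev (c :: l) x = ev l x * x + zr R c.
Proof. by []. Qed.

Lemma ev_sum l x : ev l x = \sum_(i < size l) zr R (nth 0 l i) * x ^+ i.
Proof.
elim: l => [|c l IH]; first by rewrite big_ord0.
rewrite ev_cons IH big_ord_recl mulr1 addrC mulr_suml; congr (_ + _).
by apply: eq_bigr => i _; rewrite exprSr mulrA.
Qed.

(** Truncated lists encode the partial sums that arise when a root is divided out. *)
Lemma ev_take k l x :
  ev (take k l) x = \sum_(i < k) zr R (nth 0 l i) * x ^+ i.
Proof.
rewrite ev_sum size_take_min.
rewrite (big_ord_widen k (fun i => zr R (nth 0 (take k l) i) * x ^+ i)) ?geq_minl //.
rewrite big_mkcond; apply: eq_bigr => i _; rewrite nth_take // leq_min ltn_ord /=.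
by case: ltnP => // li; rewrite nth_default // zr0 mul0r.
Qed.

(* An interval (L, U) encloses v when L <= Q * v <= U; [power_bounds] encloses
   the successive powers of a point x enclosed by (A, B). *)
Definition encloses (Q : Z) (I : Z * Z) (v : R) : bool :=
  zr R I.1 <= zr R Q * v <= zr R I.2.

Fixpoint power_bounds (A B Q : Z) (n : nat) (I : Z * Z) : seq (Z * Z) :=
  if n is n.+1 then
    I :: power_bounds A B Q n (BinInt.Z.div (BinInt.Z.mul A I.1) Q,
           BinInt.Z.succ (BinInt.Z.div (BinInt.Z.mul B I.2) Q))
  else [::].

Fixpoint eval_bounds (pw : seq (Z * Z)) (l : seq Z) : Z * Z :=
  match pw, l with
  | (L, U) :: pw, c :: l =>
      let: (L', U') := eval_bounds pw l in
      if BinInt.Z.leb 0 c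
      then (BinInt.Z.add (BinInt.Z.mul c L) L', BinInt.Z.add (BinInt.Z.mul c U) U')
      else (BinInt.Z.add (BinInt.Z.mul c U) L', BinInt.Z.add (BinInt.Z.mul c L) U')
  | _, _ => (BinNums.Z0, BinNums.Z0)
  end.

(** Induction on the list, with the exponent k of the current power carried along. Rounding down on
    the left and up on the right preserves enclosure, and nonnegative lower ends allow bounds to be
    multiplied; the sign of each coefficient decides which end of the power it meets. *)
Lemma eval_boundsP (A B Q : Z) n I k l x :
  0 <= A -> 0 < Q -> 0 <= I.1 -> encloses Q (A, B) x -> encloses Q I (x ^+ k) ->
  (size l <= n)%N ->
  encloses Q (eval_bounds (power_bounds A B Q n I) l) (x ^+ k * ev l x).
Proof.
move=> A0 Q0 + /andP[/= hA hB].
elim: l n k I => [|c l IH] [|n] k [L U] //= L0 /andP[/= hL hU] ln.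
- by rewrite /encloses /ev /= !mulr0 zr0 lexx.
- by rewrite /encloses /ev /= !mulr0 zr0 lexx.
have zQ : 0 < zr R Q by rewrite -zr0 zr_lt.
have zA : 0 <= zr R A by rewrite -zr0 zr_le.
have zL : 0 <= zr R L by rewrite -zr0 zr_le.
have divL (a b : Z) : 0 < b -> zr R b * zr R (BinInt.Z.div a b) <= zr R a.
  move=> b0; rewrite -zrM zr_le.
  by have := BinInt.Z.mul_div_le a b; lia.
have divU (a b : Z) : 0 < b -> zr R a <= zr R b * zr R (BinInt.Z.succ (BinInt.Z.div a b)).
  move=> b0; rewrite -zrM zr_le.
  by have := BinInt.Z.mul_succ_div_gt a b; lia.
have h1 : encloses Q (BinInt.Z.div (BinInt.Z.mul A L) Q,
    BinInt.Z.succ (BinInt.Z.div (BinInt.Z.mul B U) Q)) (x ^+ k.+1).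
  have e : zr R Q * (zr R Q * x ^+ k.+1) = (zr R Q * x) * (zr R Q * x ^+ k).
    by rewrite exprS; ring.
  apply/andP; split => /=; rewrite -(ler_pM2l zQ) e.
    by apply: (le_trans (divL _ _ Q0)); rewrite (zrM A L) ler_pM.
  apply: le_trans (divU _ _ Q0); rewrite (zrM B U).
  by apply: ler_pM => //; [exact: le_trans hA | exact: le_trans hL].
have L1 : 0 <= BinInt.Z.div (BinInt.Z.mul A L) Q.
  by have := BinInt.Z.div_pos (BinInt.Z.mul A L) Q; nia.
have := IH n k.+1 (_, _) L1 h1 ln.
case: (eval_bounds _ l) => [L' U'] /andP[/= hL' hU'].
have e : zr R Q * (x ^+ k * ev (c :: l) x) =
    zr R c * (zr R Q * x ^+ k) + zr R Q * (x ^+ k.+1 * ev l x).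
  by rewrite ev_cons exprS; ring.
case: ifP => c0; apply/andP; rewrite /= e.
  have c0' : 0 <= zr R c by rewrite -zr0 zr_le; lia.
  rewrite (zrD (BinInt.Z.mul c L)) (zrD (BinInt.Z.mul c U)) (zrM c L) (zrM c U).
  by split; rewrite lerD // ler_wpM2l.
have c0' : zr R c <= 0 by rewrite -zr0 zr_le; lia.
rewrite (zrD (BinInt.Z.mul c U)) (zrD (BinInt.Z.mul c L)) (zrM c L) (zrM c U).
by split; rewrite lerD // ler_wnM2l.
Qed.

Definition unit_powers (A B Q : Z) (n : nat) := power_bounds A B Q n (Q, Q).

Lemma unit_powersP (A B Q : Z) n l x :
  0 <= A -> 0 < Q -> encloses Q (A, B) x -> (size l <= n)%N ->
  encloses Q (eval_bounds (unit_powers A B Q n) l) (ev l x).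
Proof.
move=> A0 Q0 hx ln; rewrite -[ev l x]mul1r -[1](expr0 x).
apply: eval_boundsP => //=; first exact: ltW.
by rewrite /encloses /= mulr1 lexx.
Qed.

Definition ev_pos (A B Q : Z) l : bool :=
  BinInt.Z.ltb 0 (eval_bounds (unit_powers A B Q (size l)) l).1.

Lemma ev_posP (A B Q : Z) (l : seq Z) (x : R) :
  0 <= A -> 0 < Q -> encloses Q (A, B) x -> ev_pos A B Q l -> 0 < ev l x.
Proof.
move=> A0 Q0 hx; rewrite /ev_pos.
have /andP[hL _] := unit_powersP _ _ _ _ _ _ A0 Q0 hx (leqnn (size l)) => L0.
have zQ : 0 < zr R Q by rewrite -zr0 zr_lt.
rewrite -(pmulr_rgt0 _ zQ); apply: lt_le_trans hL; rewrite -zr0 zr_lt.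
by move: L0; lia.
Qed.

Definition abs_bound (pw : seq (Z * Z)) (l : seq Z) : Z :=
  let: (L, U) := eval_bounds pw l in BinInt.Z.max (BinInt.Z.opp L) U.

Lemma abs_boundP (A B Q : Z) n (l : seq Z) (x : R) :
  0 <= A -> 0 < Q -> encloses Q (A, B) x -> (size l <= n)%N ->
  zr R Q * `|ev l x| <= zr R (abs_bound (unit_powers A B Q n) l).
Proof.
move=> A0 Q0 hx ln; rewrite /abs_bound.
have := unit_powersP _ _ _ _ _ _ A0 Q0 hx ln.
case: (eval_bounds _ _) => [L U] /andP[/= hL hU].
have zQ : 0 <= zr R Q by rewrite -zr0 zr_le ltW.
rewrite -[X in X * _]ger0_norm // -normrM ler_norml.
apply/andP; split.
  by apply: le_trans hL; rewrite -zrN zr_le; lia.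
by apply: (le_trans hU); rewrite zr_le; lia.
Qed.
End ZR.

Lemma ev_root (R : realType) (A B Q : Z) (M : seq Z) :
  0 < A -> A <= B -> 0 < Q -> ev_pos A A Q M -> ev_pos B B Q (lscale (-1) M) ->
  exists x : R, encloses R Q (A, B) x /\ ev R M x = 0.
Proof.
move=> A0 AB Q0 hA hB.
have Q0' : 0 < zr R Q by rewrite -zr0 zr_lt.
have Qd (c : Z) : encloses R Q (c, c) (zr R c / zr R Q).
  by rewrite /encloses mulrC divfK ?lexx // gt_eqF.
have h1 := ev_posP _ _ _ _ _ _ (ltW A0) Q0 (Qd A) hA.
have h2 := ev_posP _ _ _ _ _ _ (le_trans (ltW A0) AB) Q0 (Qd B) hB.
(* The polynomial goes from positive to negative, whereas [poly_ivt] expects the opposite change of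
   sign. *)
have [||x /andP[Ax xB] rx] := @poly_ivt R (- Poly (map (zr R) M))
    (zr R A / zr R Q) (zr R B / zr R Q).
- by rewrite ler_pM2r ?invr_gt0 // zr_le.
- rewrite !hornerN !horner_Poly -!/(ev R M _) oppr_le0 (ltW h1) /=.
  by move: h2; rewrite ev_scale (zrN R 1) zr1 mulN1r => /ltW.
exists x; split.
  by rewrite /encloses -ler_pdivrMl // mulrC Ax /= mulrC -ler_pdivlMr.
by move: rx; rewrite /root hornerN oppr_eq0 horner_Poly => /eqP.
Qed.

(** * Certified convergence of integer recurrences *)

Definition lsum (ls : seq (seq Z)) := foldr ladd [::] ls.

(** This is the denominator of the limit: each inner truncation is a coefficient of the recurrence
    left after dividing out the root, and at a root x the whole equals - x M'(x). The next
    definition is the matching numerator, the conserved quantity at n = 0. *)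
Definition prefix_sum (M : seq Z) : seq Z :=
  lsum [seq take k.+1 M | k <- iota 0 (size M).-1].

Definition invariant_value (M : seq Z) (l : nat -> Z) : seq Z :=
  let K := (size M).-2 in
  lsum [seq lscale (l (K - k)%N) (nseq (K - k) 0 ++ take k.+1 M)
       | k <- iota 0 (size M).-1].

Definition dominated (A B Q : Z) (M : seq Z) : bool :=
  let pw := unit_powers A B Q (size M) in
  BinInt.Z.ltb
    (foldr BinInt.Z.add 0
      [seq abs_bound pw (take k.+1 M) | k <- iota 1 (size M).-2])
    (BinInt.Z.mul Q (head 0 M)).

Lemma ev_lsum (R : realDomainType) (I : Type) (s : seq I) (f : I -> seq Z) x :
  ev R (lsum [seq f i | i <- s]) x = \sum_(i <- s) ev R (f i) x.
Proof.
by elim: s => [|i s IH]; rewrite ?big_nil // big_cons /= ev_add IH.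
Qed.

(** As [M] starts with the leading coefficient, [ev R M] is the reversed characteristic polynomial
    and x is the inverse of a growth rate. The weighted sequence l n x^n has recurrence coefficients
    M_k x^k, whose sum is 0; summation by parts gives a recurrence with constant right-hand side, to
    which domination applies. *)
Lemma linear_recurrence_cvg (R : realType) (A B Q : Z) (M : seq Z)
    (l : nat -> Z) (x : R) :
  (2 < size M)%N ->
  (forall n, \sum_(k < size M) nth 0 M k * l (n + ((size M).-1 - k))%N = 0) ->
  0 <= A -> 0 < Q -> encloses R Q (A, B) x -> ev R M x = 0 ->
  dominated A B Q M ->
  zr R (l n) * x ^+ n @[n --> \oo] -->
    ev R (invariant_value M l) x / ev R (prefix_sum M) x.
Proof.
rewrite /dominated /invariant_value /prefix_sum.
case eM : (size M) => [|[|[|K]]] // _.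
rewrite -[K.+3.-1]/K.+2 -[K.+3.-2]/K.+1 => rec A0 Q0 hx rx dom.
pose q k := zr R (nth 0 M k) * x ^+ k.
pose a n := zr R (l n) * x ^+ n.
pose p k := \sum_(i < k.+1) q i.
have evp k : ev R (take k.+1 M) x = p k by exact: ev_take.
have -> : ev R (lsum [seq take k.+1 M | k <- iota 0 K.+2]) x =
    \sum_(k < K.+2) p k.
  rewrite ev_lsum -[iota 0 K.+2]/(index_iota 0 K.+2) big_mkord.
  by apply: eq_bigr => i _; rewrite evp.
have -> : ev R (lsum [seq lscale (l (K.+1 - k)%N)
       (nseq (K.+1 - k) 0 ++ take k.+1 M) | k <- iota 0 K.+2]) x =
    \sum_(k < K.+2) p k * a (K.+1 - k)%N.
  rewrite ev_lsum -[iota 0 K.+2]/(index_iota 0 K.+2) big_mkord.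
  by apply: eq_bigr => i _; rewrite ev_scale ev_nseq0 evp /a; ring.
apply: dominated_recurrence_cvg.
  have sz0 : 0 < zr R Q by rewrite -zr0 zr_lt.
  rewrite -(ltr_pM2l sz0) /p big_ord1 /q expr0 mulr1 mulr_sumr nth0 -zrM.
  apply: (@le_lt_trans _ _ (zr R (foldr BinInt.Z.add 0
    [seq abs_bound (unit_powers A B Q (size M)) (take k.+1 M) | k <- iota 1 K.+1])));
    last by rewrite zr_lt eM; move: dom; lia.
  have -> (s : seq nat) (f : nat -> Z) :
      zr R (foldr BinInt.Z.add 0 [seq f k | k <- s]) = \sum_(k <- s) zr R (f k).
    elim: s => [|k s IH]; first by rewrite big_nil.
    by rewrite big_cons /= (zrD R (f k)) IH.
  rewrite -[iota 1 K.+1]/(index_iota 1 K.+2) !big_nat.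
  apply: ler_sum => k /andP[_ kK].
  have kM : (size (take k.+1 M) <= size M)%N by rewrite size_take_min geq_minr.
  by have := abs_boundP R A B Q (size M) (take k.+1 M) x A0 Q0 hx kM; rewrite evp.
apply: linear_recurrence_invariant => [|n].
  by apply: etrans rx; rewrite ev_sum eM.
(* Each term of the weighted recurrence carries the same total power of x. *)
transitivity (x ^+ (n + K.+2) *
  zr R (\sum_(k < K.+3) nth 0 M k * l (n + (K.+2 - k))%N)).
  rewrite (big_morph (zr R) (zrD R) (zr0 R)) mulr_sumr; apply: eq_bigr => k _.
  rewrite /q /a zrM.
  have -> : (n + K.+2 = k + (n + (K.+2 - k)))%N by have := ltn_ord k; lia.
  rewrite [in RHS]exprD; set u := x ^+ k; set v := x ^+ _; ring.
by rewrite rec zr0 mulr0.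
Qed.

(** * The transfer system *)

(* This is [\sum_(1 <= k <= n) f (n - k) k]: a block of k cells is placed and
   n - k cells remain. *)
Definition diag_sum (f : nat -> nat -> Z) (n : nat) : Z :=
  \sum_(k < n) f (n.-1 - k)%N k.+1.

Lemma diag_sum0 f : diag_sum f 0 = 0.
Proof. by rewrite /diag_sum big_ord0. Qed.

Lemma diag_sumS f n :
  diag_sum f n.+1 = f n 1%N + diag_sum (fun m k => f m k.+1) n.
Proof.
rewrite /diag_sum big_ord_recl subn0; congr (_ + _); apply: eq_bigr => k _.
by congr (f _ _); rewrite /= /bump /=; have := ltn_ord k; lia.
Qed.

Lemma eq_diag_sum f g n :
  (forall m k, (m < n)%N -> (0 < k)%N -> f m k = g m k) ->
  diag_sum f n = diag_sum g n.
Proof.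
by move=> fg; apply: eq_bigr => k _; apply: fg => //; have := ltn_ord k; lia.
Qed.

Lemma diag_sumD f g n :
  diag_sum (fun m k => f m k + g m k) n = diag_sum f n + diag_sum g n.
Proof. by rewrite /diag_sum big_split. Qed.

Lemma diag_sumB f g n :
  diag_sum (fun m k => f m k - g m k) n = diag_sum f n - diag_sum g n.
Proof. by rewrite /diag_sum sumrB. Qed.

Lemma diag_sumZ c f n : diag_sum (fun m k => c * f m k) n = c * diag_sum f n.
Proof. by rewrite /diag_sum mulr_sumr. Qed.

(** Both sides run over the pairs of positive c, d with c + d <= n; [aux] rewrites the dependent
    range as a condition symmetric in the two indices. *)
Lemma diag_sum_swap (f : nat -> nat -> nat -> Z) n :
  diag_sum (fun m c => diag_sum (fun m d => f m c d) m) n =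
  diag_sum (fun m d => diag_sum (fun m c => f m c d) m) n.
Proof.
rewrite /diag_sum.
have aux (g : nat -> nat -> nat -> Z) :
    \sum_(k < n) \sum_(j < n.-1 - k) g ((n.-1 - k).-1 - j)%N k.+1 j.+1 =
    \sum_(k < n) \sum_(j < n | (k + j < n.-1)%N) g (n.-2 - (k + j))%N k.+1 j.+1.
  apply: eq_bigr => k _.
  rewrite (big_ord_widen_cond n xpredT
    (fun j => g ((n.-1 - k).-1 - j)%N k.+1 j.+1)); last first.
    by have := ltn_ord k; lia.
  apply: eq_big => [j|j _]; first by apply/idP/idP; lia.
  by congr (g _ _ _); lia.
rewrite (aux f) (aux (fun m d c => f m c d)) (exchange_big_dep xpredT) //=.
by apply: eq_bigr => j _; apply: eq_big => [k|k _]; rewrite addnC.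
Qed.

Notation zn := BinInt.Z.of_nat.

(* A run of a cells, a gap of g cells and a run of b cells, from bottom to top;
   a connected column is encoded by g = b = 0. *)
Definition wf_shape (a g b : nat) : bool :=
  (0 < a)%N && (((g == 0%N) && (b == 0%N)) ||
    [&& (0 < g)%N, (g <= 3)%N & (0 < b)%N]).

(* T n a g b stands for the number of ways to extend to the right, by n cells, a
   polyomino with last column (a, g, b); the factors count the positions of the
   next column, which is (k, 0, 0) or (c, h + 1, d). *)
Definition shape_recurrence (T : nat -> nat -> nat -> nat -> Z) : Prop :=
  forall n a g b, wf_shape a g b ->
  T n a g b = zn (n == 0)%N +
    diag_sum (fun m k => (zn (a + g + b + k) - zn (g - k)) * T m k 0 0) n +
    \sum_(h < 3) diag_sum (fun m c => diag_sum (fun m d =>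
       (zn (a + g + b - h.+1) - zn (g - c - (h.+1 - b))
          - zn (g - d - (h.+1 - a))) * T m c h.+1 d) m) n.

Section Automaton.
Variable T : nat -> nat -> nat -> nat -> Z.
Hypothesis T_rec : shape_recurrence T.

(** This is the reflection of polyominoes upside down. In the recurrence it amounts to exchanging
    the two runs of the next column, hence the two summations. *)
Lemma T_sym n a g b : wf_shape a g.+1 b -> T n a g.+1 b = T n b g.+1 a.
Proof.
elim/ltn_ind: n a g b => n IH a g b wf.
have wf' : wf_shape b g.+1 a by move: wf; rewrite /wf_shape; lia.
rewrite !T_rec //; congr (_ + _ + _).
  by apply: eq_diag_sum => m k _ _; congr ((zn _ - _) * _); lia.
apply: eq_bigr => h _.
rewrite diag_sum_swap; apply: eq_diag_sum => m c mn c0.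
apply: eq_diag_sum => m' d m'm d0.
rewrite (IH m') //; last by move: (ltn_ord h); rewrite /wf_shape; lia.
  congr (_ * _); lia.
exact: ltn_trans mn.
Qed.

(* In these sums a run of length k + j is charged for k cells only, so that
   passing from n to n + 1 increments the index j. *)
Definition sX j := diag_sum (fun m k => T m (k + j) 0 0).
Definition sW j := diag_sum (fun m k => zn k * T m (k + j) 0 0).
Definition sP h i j := diag_sum (fun m d => T m i.+1 h.+1 (d + j)).
Definition sV h i :=
  diag_sum (fun m c => diag_sum (fun m d => T m (c + i) h.+1 d) m).
(** Since g <= 3, the corrections concern only runs of length 1 and 2. A run of length 2 is reached
    in two steps of n, through the intermediate sums [sE2] and [sR2], which charge for one cell
    only. *)
Definition sD1 := diag_sum (fun m k => zn (k == 1)%N * T m k 0 0).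
Definition sE2 := diag_sum (fun m k => zn (k == 1)%N * T m k.+1 0 0).
Definition sD2 := diag_sum (fun m k => zn (k == 2)%N * T m k 0 0).
Definition sQ1 h :=
  diag_sum (fun m c => zn (c == 1)%N * diag_sum (fun m d => T m c h.+1 d) m).
Definition sR2 h :=
  diag_sum (fun m c => zn (c == 1)%N * diag_sum (fun m d => T m c.+1 h.+1 d) m).
Definition sQ2 h :=
  diag_sum (fun m c => zn (c == 2)%N * diag_sum (fun m d => T m c h.+1 d) m).

(** The truncated differences in the recurrence vanish for runs of length at least 3, so they are
    combinations of the indicators of lengths 1 and 2; what remains depends on the shape only
    through scalar factors. *)
Lemma T_expand n a g b : wf_shape a g b ->
  T n a g b = zn (n == 0)%N + zn (a + g + b) * sX 0 n + sW 0 n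
    - zn (g - 1) * sD1 n - zn (g - 2) * sD2 n
    + \sum_(h < 3) (zn (a + g + b - h.+1) * sV h 0 n
        - (zn (g - 1 - (h.+1 - b)) + zn (g - 1 - (h.+1 - a))) * sQ1 h n
        - (zn (g - 2 - (h.+1 - b)) + zn (g - 2 - (h.+1 - a))) * sQ2 h n).
Proof.
move=> wf; have g3 : (g <= 3)%N by move: wf; rewrite /wf_shape; lia.
rewrite T_rec //; congr (_ + _).
  rewrite -!addrA; congr (_ + _).
  rewrite -!mulNr /sX /sW /sD1 /sD2 -!diag_sumZ -!diag_sumD.
  apply: eq_diag_sum => m k _ k0; rewrite addn0.
  have -> : zn (g - k) = zn (g - 1) * zn (k == 1)%N + zn (g - 2) * zn (k == 2)%N.
    by case: k k0 => [|[|[|k]]] //= _; lia.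
  rewrite [zn (_ + k)](_ : _ = zn (a + g + b) + zn k); last by lia.
  by ring.
apply: eq_bigr => h _.
pose U c := diag_sum (fun m c' =>
  zn (c' == c)%N * diag_sum (fun m d => T m c' h.+1 d) m) n.
have coef x c : (0 < c)%N -> zn (g - c - x) =
    zn (g - 1 - x) * zn (c == 1)%N + zn (g - 2 - x) * zn (c == 2)%N.
  by case: c => [|[|[|c]]] //= _; lia.
have left x : diag_sum (fun m c => diag_sum (fun m d =>
     zn (g - c - x) * T m c h.+1 d) m) n =
    zn (g - 1 - x) * U 1%N + zn (g - 2 - x) * U 2%N.
  rewrite /U -!diag_sumZ -!diag_sumD; apply: eq_diag_sum => m c _ c0.
  by rewrite diag_sumZ coef //; ring.
(* By symmetry, a correction on the upper run equals one on the lower run, so the same sums [U]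
   serve for both. *)
have right x : diag_sum (fun m c => diag_sum (fun m d =>
     zn (g - d - x) * T m c h.+1 d) m) n =
    zn (g - 1 - x) * U 1%N + zn (g - 2 - x) * U 2%N.
  rewrite diag_sum_swap -left; apply: eq_diag_sum => m c _ c0.
  apply: eq_diag_sum => m' d _ d0; congr (_ * _).
  by apply: T_sym; move: (ltn_ord h); rewrite /wf_shape; lia.
transitivity (zn (a + g + b - h.+1) * sV h 0 n
   - (zn (g - 1 - (h.+1 - b)) * U 1%N + zn (g - 2 - (h.+1 - b)) * U 2%N)
   - (zn (g - 1 - (h.+1 - a)) * U 1%N + zn (g - 2 - (h.+1 - a)) * U 2%N)); last first.
  by rewrite /U /sQ1 /sQ2; ring.
rewrite -left -right /sV -!diag_sumZ -!diag_sumB.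
apply: eq_diag_sum => m c _ _; rewrite -!diag_sumZ -!diag_sumB.
by apply: eq_diag_sum => m' d _ _; rewrite addn0; ring.
Qed.

(** For a >= 3 the difference [h.+1 - a] is 0 and [a + g + b - h.+1] is not truncated, so a enters
    linearly. *)
Lemma T_expand_large n a g b : (2 < a)%N -> wf_shape a g b ->
  T n a g b = zn a * (sX 0 n + \sum_(h < 3) sV h 0 n)
    + (zn (n == 0)%N + zn (g + b) * sX 0 n + sW 0 n
    - zn (g - 1) * sD1 n - zn (g - 2) * sD2 n
    + \sum_(h < 3) ((zn (g + b) - zn h.+1) * sV h 0 n
        - (zn (g - 1 - (h.+1 - b)) + zn (g - 1)) * sQ1 h n
        - (zn (g - 2 - (h.+1 - b)) + zn (g - 2)) * sQ2 h n)).
Proof.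
move=> a2 wf; rewrite T_expand //.
have -> : zn (a + g + b) = zn a + zn (g + b) by lia.
pose G (h : 'I_3) := (zn (g + b) - zn h.+1) * sV h 0 n
  - (zn (g - 1 - (h.+1 - b)) + zn (g - 1)) * sQ1 h n
  - (zn (g - 2 - (h.+1 - b)) + zn (g - 2)) * sQ2 h n.
rewrite -[X in _ = _ + (_ + X)]/(\sum_(h < 3) G h).
rewrite (eq_bigr (fun h : 'I_3 => zn a * sV h 0 n + G h)) => [|h _].
  by rewrite big_split -mulr_sumr /=; ring.
have -> : zn (a + g + b - h.+1) = zn a + zn (g + b) - zn h.+1.
  by have := ltn_ord h; lia.
have -> : (h.+1 - a = 0)%N by have := ltn_ord h; lia.
by rewrite /G !subn0; ring.
Qed.

Lemma T_affine n a g b : (2 < a)%N -> wf_shape a g b ->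
  T n a.+2 g b = 2 * T n a.+1 g b + -1 * T n a g b.
Proof.
move=> a2 wf; have wf1 : wf_shape a.+1 g b by move: wf; rewrite /wf_shape; lia.
have wf2 : wf_shape a.+2 g b by move: wf; rewrite /wf_shape; lia.
have [a1 a3] : (2 < a.+1)%N /\ (2 < a.+2)%N by lia.
rewrite !T_expand_large //.
have -> : zn a.+2 = zn a + 2 by lia.
have -> : zn a.+1 = zn a + 1 by lia.
by ring.
Qed.

Lemma sX_step j n : sX j n.+1 = T n j.+1 0 0 + sX j.+1 n.
Proof.
rewrite /sX diag_sumS; congr (_ + _).
by apply: eq_diag_sum => m k _ _; rewrite addnS.
Qed.

Lemma sW_step j n : sW j n.+1 = T n j.+1 0 0 + sX j.+1 n + sW j.+1 n.
Proof.
rewrite /sW /sX diag_sumS mul1r -addrA -diag_sumD; congr (_ + _).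
apply: eq_diag_sum => m k _ _; rewrite addnS addSn.
have -> : zn k.+1 = 1 + zn k by lia.
by ring.
Qed.

Lemma sP_step h i j n : sP h i j n.+1 = T n i.+1 h.+1 j.+1 + sP h i j.+1 n.
Proof.
rewrite /sP diag_sumS; congr (_ + _).
by apply: eq_diag_sum => m k _ _; rewrite addnS.
Qed.

Lemma sV_step h i n : sV h i n.+1 = sP h i 0 n + sV h i.+1 n.
Proof.
rewrite /sV diag_sumS; congr (_ + _).
  by apply: eq_diag_sum => m k _ _; rewrite addn0.
apply: eq_diag_sum => m k _ _; apply: eq_diag_sum => m' k' _ _.
by rewrite addnS.
Qed.

Lemma sD1_step n : sD1 n.+1 = T n 1 0 0.
Proof.
rewrite /sD1 diag_sumS mul1r -[RHS]addr0; congr (_ + _).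
by apply: big1 => k _; rewrite mul0r.
Qed.

Lemma sE2_step n : sE2 n.+1 = T n 2 0 0.
Proof.
rewrite /sE2 diag_sumS mul1r -[RHS]addr0; congr (_ + _).
by apply: big1 => k _; rewrite mul0r.
Qed.

Lemma sD2_step n : sD2 n.+1 = sE2 n.
Proof. by rewrite /sD2 diag_sumS mul0r add0r. Qed.

Lemma sQ1_step h n : sQ1 h n.+1 = sP h 0 0 n.
Proof.
rewrite /sQ1 diag_sumS mul1r -[RHS]addr0; congr (_ + _).
  by apply: eq_diag_sum => m k _ _; rewrite addn0.
by apply: big1 => k _; rewrite mul0r.
Qed.

Lemma sR2_step h n : sR2 h n.+1 = sP h 1 0 n.
Proof.
rewrite /sR2 diag_sumS mul1r -[RHS]addr0; congr (_ + _).
  by apply: eq_diag_sum => m k _ _; rewrite addn0.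
by apply: big1 => k _; rewrite mul0r.
Qed.

Lemma sQ2_step h n : sQ2 h n.+1 = sR2 h n.
Proof. by rewrite /sQ2 diag_sumS mul0r add0r. Qed.

(** With k >= 1 the runs k + 2, k + 3, k + 4 all lie in the affine range. This and the next three
    lemmas express index 4 by indices 3 and 2, which closes the system in finite dimension. *)
Lemma sX_tail n : sX 4 n = 2 * sX 3 n + -1 * sX 2 n.
Proof.
rewrite /sX -!diag_sumZ -!diag_sumD; apply: eq_diag_sum => m k _ k0.
by rewrite !addnS addn0 T_affine // /wf_shape; lia.
Qed.

Lemma sW_tail n : sW 4 n = 2 * sW 3 n + -1 * sW 2 n.
Proof.
rewrite /sW -!diag_sumZ -!diag_sumD; apply: eq_diag_sum => m k _ k0.
by rewrite !addnS addn0 T_affine ?/wf_shape; [ring | lia | lia].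
Qed.

Lemma sV_tail h n : (h < 3)%N -> sV h 4 n = 2 * sV h 3 n + -1 * sV h 2 n.
Proof.
move=> h3; rewrite /sV -!diag_sumZ -!diag_sumD; apply: eq_diag_sum => m k _ k0.
rewrite -!diag_sumZ -!diag_sumD; apply: eq_diag_sum => m' k' _ k'0.
by rewrite !addnS addn0 T_affine // /wf_shape; lia.
Qed.

Lemma sP_tail h i n : (h < 3)%N -> sP h i 4 n = 2 * sP h i 3 n + -1 * sP h i 2 n.
Proof.
move=> h3; rewrite /sP -!diag_sumZ -!diag_sumD; apply: eq_diag_sum => m k _ k0.
(* Here the growing run is the upper one, so it is first brought to the bottom. *)
rewrite !addnS addn0 !(T_sym _ i.+1); try by rewrite /wf_shape; lia.
by rewrite T_affine // /wf_shape; lia.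
Qed.

End Automaton.

(** * The transfer matrix, as linear forms on a state vector *)

Fixpoint dot (F v : seq Z) : Z :=
  match F, v with
  | c :: F, x :: v => c * x + dot F v
  | _, _ => 0
  end.

Lemma dot_add F G v : dot (ladd F G) v = dot F v + dot G v.
Proof.
elim: F G v => [|c F IH] [|d G] [|x v] //=; rewrite ?add0r ?addr0 //.
by rewrite IH; ring.
Qed.

Lemma dot_scale c F v : dot (lscale c F) v = c * dot F v.
Proof. by elim: F v => [|d F IH] [|x v] /=; rewrite ?mulr0 // IH; ring. Qed.

Lemma dot_sum (I : Type) (s : seq I) (f : I -> seq Z) v :
  dot (lsum [seq f i | i <- s]) v = \sum_(i <- s) dot (f i) v.
Proof.
elim: s => [|i s IH]; first by rewrite big_nil.
by rewrite /= dot_add IH big_cons.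
Qed.

Definition basis (i : nat) : seq Z := rcons (nseq i 0) 1.

Lemma dot_basis i v : dot (basis i) v = nth 0 v i.
Proof.
elim: i v => [|i IH] [|x v] //=; last by rewrite mul0r add0r.
by rewrite mul1r addr0.
Qed.

Notation "F |+| G" := (ladd F G) (at level 50, left associativity).
Notation "c |*| F" := (lscale c F) (at level 40, left associativity).

(** The offsets follow the order of [state]: 1 initial entry, 4 for [sX], 4 for [sW], 12 for [sV],
    48 for [sP], then 3 + 9 for the short runs, 81 in all. *)
Definition iX j := basis (1 + j).
Definition iW j := basis (5 + j).
Definition iV h i := basis (9 + (4 * h + i)).
Definition iP h i j := basis (21 + (16 * h + (4 * i + j))).
Definition iD1 := basis 69.
Definition iE2 := basis 70.
Definition iD2 := basis 71.
Definition iQ1 h := basis (72 + h).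
Definition iR2 h := basis (75 + h).
Definition iQ2 h := basis (78 + h).

(* The families are affine in their index from 2 on. *)
Definition cap (f : nat -> seq Z) (j : nat) : seq Z :=
  if (j < 4)%N then f j else 2 |*| f 3 |+| -1 |*| f 2.

Definition T_form (a g b : nat) : seq Z :=
  basis 0 |+| zn (a + g + b) |*| iX 0 |+| iW 0
    |+| - zn (g - 1) |*| iD1 |+| - zn (g - 2) |*| iD2
    |+| lsum [seq zn (a + g + b - h.+1) |*| iV h 0
        |+| - (zn (g - 1 - (h.+1 - b)) + zn (g - 1 - (h.+1 - a))) |*| iQ1 h
        |+| - (zn (g - 2 - (h.+1 - b)) + zn (g - 2 - (h.+1 - a))) |*| iQ2 h
        | h <- iota 0 3].

(** The rows come in the order of [state]. The first is empty because [zn (n == 0)] vanishes after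
    one step. *)
Definition transfer_rows : seq (seq Z) :=
  [::] ::
  [seq T_form j.+1 0 0 |+| cap iX j.+1 | j <- iota 0 4] ++
  [seq T_form j.+1 0 0 |+| cap iX j.+1 |+| cap iW j.+1 | j <- iota 0 4] ++
  [seq iP h i 0 |+| cap (iV h) i.+1 | h <- iota 0 3, i <- iota 0 4] ++
  [seq T_form ij.1.+1 h.+1 ij.2.+1 |+| cap (iP h ij.1) ij.2.+1
    | h <- iota 0 3, ij <- [seq (i, j) | i <- iota 0 4, j <- iota 0 4]] ++
  [:: T_form 1 0 0; T_form 2 0 0; iE2] ++
  [seq iP h 0 0 | h <- iota 0 3] ++ [seq iP h 1 0 | h <- iota 0 3] ++
  [seq iR2 h | h <- iota 0 3].

Section State.
Variable T : nat -> nat -> nat -> nat -> Z.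
Hypothesis T_rec : shape_recurrence T.

Definition state (n : nat) : seq Z :=
  zn (n == 0)%N ::
  [seq sX T j n | j <- iota 0 4] ++
  [seq sW T j n | j <- iota 0 4] ++
  [seq sV T h i n | h <- iota 0 3, i <- iota 0 4] ++
  [seq sP T h ij.1 ij.2 n
    | h <- iota 0 3, ij <- [seq (i, j) | i <- iota 0 4, j <- iota 0 4]] ++
  [:: sD1 T n; sE2 T n; sD2 T n] ++
  [seq sQ1 T h n | h <- iota 0 3] ++ [seq sR2 T h n | h <- iota 0 3] ++
  [seq sQ2 T h n | h <- iota 0 3].

Lemma dot_iX j n : (j < 4)%N -> dot (iX j) (state n) = sX T j n.
Proof. by rewrite dot_basis; case: j => [|[|[|[|]]]]. Qed.

Lemma dot_iW j n : (j < 4)%N -> dot (iW j) (state n) = sW T j n.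
Proof. by rewrite dot_basis; case: j => [|[|[|[|]]]]. Qed.

Lemma dot_iV h i n : (h < 3)%N -> (i < 4)%N ->
  dot (iV h i) (state n) = sV T h i n.
Proof.
by rewrite dot_basis; case: h => [|[|[|]]] //; case: i => [|[|[|[|]]]].
Qed.

Lemma dot_iP h i j n : (h < 3)%N -> (i < 4)%N -> (j < 4)%N ->
  dot (iP h i j) (state n) = sP T h i j n.
Proof.
rewrite dot_basis; case: h => [|[|[|]]] //; case: i => [|[|[|[|]]]] //;
by case: j => [|[|[|[|]]]].
Qed.

Lemma dot_iQ1 h n : (h < 3)%N -> dot (iQ1 h) (state n) = sQ1 T h n.
Proof. by rewrite dot_basis; case: h => [|[|[|]]]. Qed.

Lemma dot_iR2 h n : (h < 3)%N -> dot (iR2 h) (state n) = sR2 T h n.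
Proof. by rewrite dot_basis; case: h => [|[|[|]]]. Qed.

Lemma dot_iQ2 h n : (h < 3)%N -> dot (iQ2 h) (state n) = sQ2 T h n.
Proof. by rewrite dot_basis; case: h => [|[|[|]]]. Qed.

Lemma dot_T_form a g b n : wf_shape a g b ->
  dot (T_form a g b) (state n) = T n a g b.
Proof.
move=> wf; rewrite (T_expand T T_rec) // /T_form dot_add dot_sum !dot_add !dot_scale.
rewrite dot_iX // dot_iW // !dot_basis.
have -> : iota 0 3 = index_iota 0 3 by [].
rewrite big_mkord !mulNr; congr (_ + _); apply: eq_bigr => h _.
by rewrite !dot_add !dot_scale dot_iV // dot_iQ1 // dot_iQ2 // !mulNr.
Qed.

Lemma dot_cap (f : nat -> seq Z) (s : nat -> Z) j n :
  (forall j, (j < 4)%N -> dot (f j) (state n) = s j) ->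
  s 4%N = 2 * s 3%N + -1 * s 2%N -> (j < 4)%N ->
  dot (cap f j.+1) (state n) = s j.+1.
Proof.
move=> fs s4 j4; rewrite /cap; case: ltnP => [|j3]; first exact: fs.
have -> : j = 3%N by lia.
by rewrite dot_add !dot_scale !fs.
Qed.

Lemma state_step n : state n.+1 = [seq dot F (state n) | F <- transfer_rows].
Proof.
have mapE (I : eqType) (s : seq I) (f : I -> Z) (g : I -> seq Z) :
    {in s, forall i, f i = dot (g i) (state n)} ->
    [seq f i | i <- s] = [seq dot F (state n) | F <- [seq g i | i <- s]].
  by move=> fg; rewrite -map_comp; apply/eq_in_map.
have allE (I J : eqType) (s : seq I) (t : seq J) f (g : I -> J -> seq Z) :
    {in s & t, forall i j, f i j = dot (g i j) (state n)} ->
    [seq f i j | i <- s, j <- t] =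
    [seq dot F (state n) | F <- [seq g i j | i <- s, j <- t]].
  move=> fg; rewrite map_allpairs; apply/eq_in_allpairs => i j si tj.
  exact: fg.
have catE (s s' : seq Z) t t' :
    s = [seq dot F (state n) | F <- t] -> s' = [seq dot F (state n) | F <- t'] ->
    s ++ s' = [seq dot F (state n) | F <- t ++ t'].
  by move=> -> ->; rewrite map_cat.
have lt4 (P : nat -> Prop) :
    (forall j, (j < 4)%N -> P j) -> forall j, j \in iota 0 4 -> P j.
  by move=> hP j; rewrite mem_iota => /hP.
have lt3 (P : nat -> Prop) :
    (forall j, (j < 3)%N -> P j) -> forall j, j \in iota 0 3 -> P j.
  by move=> hP j; rewrite mem_iota => /hP.
have wf1 j : wf_shape j.+1 0 0 by [].
have capX j : (j < 4)%N -> dot (cap iX j.+1) (state n) = sX T j.+1 n.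
  apply: (dot_cap _ (fun j => sX T j n)) => [i|]; first exact: dot_iX.
  exact: (sX_tail T T_rec).
rewrite /state /transfer_rows map_cons -/(state n); congr (_ :: _).
(* The eight blocks after the initial entry are treated separately, each by its step lemma; the tail
   lemmas enter through [cap]. *)
refine (catE _ _ _ _ _ (catE _ _ _ _ _ (catE _ _ _ _ _ (catE _ _ _ _ _
  (catE _ _ _ _ _ (catE _ _ _ _ _ (catE _ _ _ _ _ _))))))).
- apply: mapE; apply: (lt4) => j j4.
  by rewrite dot_add dot_T_form // capX // sX_step.
- apply: mapE; apply: (lt4) => j j4.
  rewrite 2!dot_add dot_T_form // capX // sW_step.
  congr (_ + _); apply/esym; apply: (dot_cap _ (fun j => sW T j n)) => // [i|].
    exact: dot_iW.
  exact: (sW_tail T T_rec).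
- apply: allE => h i hh; move: i; move: h hh; apply: lt3 => h h3; apply: (lt4) => i i4.
  rewrite dot_add dot_iP // sV_step.
  congr (_ + _); apply/esym; apply: (dot_cap _ (fun j => sV T h j n)) => // [j j4|].
    exact: dot_iV.
  exact: (sV_tail T T_rec).
- apply: allE => h ij hh /allpairsP[[i j] [ii jj ->]].
  have {}ii : i \in iota 0 4 := ii; have {}jj : j \in iota 0 4 := jj.
  rewrite -[(i, j).1]/i -[(i, j).2]/j.
  move: j jj; move: i ii; move: h hh; apply: lt3 => h h3; apply: (lt4) => i i4.
  apply: (lt4) => j j4.
  rewrite dot_add dot_T_form; last by rewrite /wf_shape; lia.
  rewrite sP_step; congr (_ + _); apply/esym.
  apply: (dot_cap _ (fun j => sP T h i j n)) => // [k k4|]; first exact: dot_iP.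
  exact: (sP_tail T T_rec).
- rewrite sD1_step sE2_step sD2_step -(dot_T_form 1) // -(dot_T_form 2) //.
  by rewrite -[sE2 T n]/(nth 0 (state n) 70) -dot_basis.
- by apply: mapE; apply: lt3 => h h3; rewrite dot_iP // sQ1_step.
- by apply: mapE; apply: lt3 => h h3; rewrite dot_iP // sR2_step.
- by apply: mapE; apply: lt3 => h h3; rewrite dot_iR2 // sQ2_step.
Qed.

End State.

(* The explicit recurrence and its numerical certificates *)
Delimit Scope Z_scope with ZZ.

Fixpoint lmul (l l' : seq Z) : seq Z :=
  if l is c :: l then ladd (lscale c l') (0%ZZ :: lmul l l') else [::].

Lemma ev_mul (R : realDomainType) l l' x : ev R (lmul l l') x = ev R l x * ev R l' x.
Proof.
elim: l => [|c l IH]; first by rewrite /ev /= mul0r.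
by rewrite /= ev_add ev_scale !ev_cons IH zr0 addr0; ring.
Qed.

(** The product of a row vector by a matrix; skipping zero entries keeps the computation on sparse
    rows short. *)
Fixpoint combine (r : seq Z) (rows : seq (seq Z)) : seq Z :=
  match r, rows with
  | c :: r, F :: rows =>
      if c is BinNums.Z0 then combine r rows else ladd (lscale c F) (combine r rows)
  | _, _ => [::]
  end.

Lemma dot_combine r rows v :
  dot (combine r rows) v = dot r [seq dot F v | F <- rows].
Proof.
elim: r rows => [|c r IH] [|F rows] //=.
have e : dot (ladd (lscale c F) (combine r rows)) v =
    c * dot F v + dot r [seq dot F v | F <- rows].
  by rewrite dot_add dot_scale IH.
by case: c e => [_|p //|p //]; rewrite IH mul0r add0r.
Qed.

Definition transfer_table := Eval vm_compute in transfer_rows.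

Lemma transfer_tableE : transfer_rows = transfer_table.
Proof. by vm_cast_no_check (erefl transfer_table). Qed.

Definition row_orbit (n : nat) : seq (seq Z) :=
  traject (fun r => combine r transfer_table) (iX 0) n.

(** An identity between the rows themselves holds on every state, so this one finite check yields
    the recurrence for all n. Coefficient k meets the power [(size M).-1 - k] because the leading
    coefficient comes first. *)
Definition annihilates (M : seq Z) : bool :=
  let rows := row_orbit (size M) in
  all (BinInt.Z.eqb 0%ZZ)
    (lsum [seq lscale (nth 0%ZZ M k) (nth [::] rows ((size M).-1 - k))
          | k <- iota 0 (size M)]).

(* The minimal polynomial, for the transfer matrix, of the row that selects
   [sX T 0]; the leading coefficient comes first. *)
Definition minimal_relation : seq Z :=
  [:: 1; -18; 142; -651; 1932; -3897; 5416; -5003; 2345; 1460; -5028; 7315;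
      -7614; 5610; -1715; -2332; 4364; -3886; 1934; 191; -1081; 332; 569; -267;
      -588; 643; 30; -367; 146; 62; -54; 8; 1; 0; 0; 0; 0]%ZZ.

(* The second factor is 10 times a truncation of the power series inverse of
   the quotient of [minimal_relation] by its dominant linear factor: this makes
   the product satisfy [dominated]. *)
Definition relation : seq Z := lmul minimal_relation
  [:: 10; 137; 1048; 5905; 27403; 111130; 408433; 1394402; 4501884; 13932187;
      41767606; 122308911; 352129510; 1001747014; 2826653823; 7933213406;
      22188826786; 61930019739; 172632331676]%ZZ.

(** Reals are scaled by 10^24. The two bounds confine the root to an interval of length 10^-15, and
    the further nine digits leave room for rounding in its powers. *)
Definition grid : Z := 1000000000000000000000000%ZZ.
Definition root_lo : Z := 233174656532074000000000%ZZ.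
Definition root_hi : Z := 233174656532075000000000%ZZ.

Definition initial_values (N : nat) : seq Z :=
  [seq head 0%ZZ r | r <- row_orbit N].

Definition limit_num : seq Z := 
  invariant_value relation (nth 0%ZZ (initial_values (size relation))).
Definition limit_den : seq Z := prefix_sum relation.

Lemma annihilates_relation : annihilates relation.
Proof. by vm_cast_no_check (erefl true). Qed.

Lemma dominated_relation : dominated root_lo root_hi grid relation.
Proof. by vm_cast_no_check (erefl true). Qed.

Lemma root_signs :
  ev_pos root_lo root_lo grid minimal_relation &&
  ev_pos root_hi root_hi grid (lscale (-1)%ZZ minimal_relation).
Proof. by vm_cast_no_check (erefl true). Qed.

Definition million : Z := 1000000%ZZ.

(** In order: x > 0, the two bounds on 1 / x, positivity of the denominator of the limit, and the
    two bounds on the limit, all with denominators cleared. *)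
Lemma limit_signs :
  [&& ev_pos root_lo root_hi grid [:: 0; 1]%ZZ,
   ev_pos root_lo root_hi grid [:: million; -4288630]%ZZ,
   ev_pos root_lo root_hi grid [:: -million; 4288631]%ZZ,
   ev_pos root_lo root_hi grid limit_den,
   ev_pos root_lo root_hi grid
     (ladd (lscale million limit_num) (lscale (-108269)%ZZ limit_den)) &
   ev_pos root_lo root_hi grid
     (ladd (lscale 108270%ZZ limit_den) (lscale (-million)%ZZ limit_num))].
Proof. by vm_cast_no_check (erefl true). Qed.

(** The constants are kappa = num / den and lambda = 1 / x; the sign hypotheses are the required
    bounds multiplied out, and the lower one on kappa makes num positive. *)
Lemma asymptotic_constants (R : realType) (u : nat -> R)
    (k1 k2 l1 l2 M x num den : R) :
  0 < k1 -> 0 < M -> 0 < x -> 0 < - l1 * x + M -> 0 < l2 * x + - M ->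
  0 < den -> 0 < M * num + - k1 * den -> 0 < k2 * den + - M * num ->
  u n * x ^+ n @[n --> \oo] --> num / den ->
  exists kappa lambda : R,
    [/\ k1 / M <= kappa < k2 / M, l1 / M <= lambda < l2 / M &
        u n / (kappa * lambda ^+ n) @[n --> \oo] --> (1 : R)].
Proof.
move=> k1_pos M0 x_pos x_lo x_hi den_pos k_lo k_hi cvg.
exists (num / den), x^-1; split.
- rewrite ler_pdivrMr // mulrAC ler_pdivlMr // ltr_pdivlMr // mulrAC ltr_pdivrMr //.
  by apply/andP; split; [apply: ltW|]; rewrite -subr_gt0; move: k_lo k_hi; lra.
- rewrite ler_pdivrMr // ltr_pdivlMr //.
  rewrite -[x^-1 * _]mulrC ler_pdivlMr // ltr_pdivrMr //.
  by apply/andP; split; [apply: ltW|]; rewrite -subr_gt0; move: x_lo x_hi; lra.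
have num_pos : 0 < num.
  have : 0 < k1 * den by rewrite mulr_gt0.
  by rewrite -(pmulr_rgt0 num M0); move: k_lo; lra.
have kd : num / den != 0 by rewrite mulf_neq0 ?invr_neq0 ?gt_eqF.
have -> : (fun n => u n / (num / den * x^-1 ^+ n)) =
    (fun n => (u n * x ^+ n) * (num / den)^-1).
  by apply/funext => n; rewrite invfM exprVn invrK mulrAC mulrA.
by rewrite -[X in _ --> X](divff kd); apply: cvgMl cvg.
Qed.

Section Asymptotics.
Variable T : nat -> nat -> nat -> nat -> Z.
Hypothesis T_rec : shape_recurrence T.

(** Multiplying the row by the transfer matrix has the same effect as advancing the state by one
    step. *)
Lemma dot_row_orbit N k n : (k < N)%N ->
  dot (nth [::] (row_orbit N) k) (state T n) = sX T 0 (n + k).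
Proof.
move=> kN; rewrite (set_nth_default (iX 0)) ?size_traject // nth_traject //.
elim: k {kN} n => [|k IH] n.
  by rewrite addn0 dot_iX.
by rewrite iterS dot_combine -transfer_tableE -(state_step T T_rec) IH addSnnS.
Qed.

Lemma annihilatesP M n : annihilates M ->
  \sum_(k < size M) nth 0 M k * sX T 0 (n + ((size M).-1 - k))%N = 0.
Proof.
rewrite /annihilates; set L := lsum _ => L0.
have dot0 v : dot L v = 0.
  elim: {+}L v L0 => [|c l IH] [|x v] //= /andP[c0 /IH ->].
  by case: c c0 => // _; rewrite mul0r.
rewrite -[RHS](dot0 (state T n)) /L dot_sum.
have -> : iota 0 (size M) = index_iota 0 (size M) by rewrite /index_iota subn0.
rewrite big_mkord.
apply: eq_bigr => k _; rewrite dot_scale dot_row_orbit //.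
by have := ltn_ord k; lia.
Qed.

(** All sums are empty at n = 0, so the initial state is the first basis vector, and pairing a row
    with it returns the head of the row. *)
Lemma initial_valuesE N k : (k < N)%N ->
  nth 0 (initial_values N) k = sX T 0 k.
Proof.
move=> kN; rewrite /initial_values (nth_map [::]) ?size_traject //.
rewrite -[sX T 0 k]/(sX T 0 (0 + k)) -(dot_row_orbit _ _ 0 kN) -nth0.
have -> : state T 0 = 1 :: nseq 80 0.
  by rewrite /state /= /sX /sW /sV /sP /sD1 /sE2 /sD2 /sQ1 /sR2 /sQ2 !diag_sum0.
case: (nth _ _ k) => [//|c l] /=.
have -> : dot l (nseq 80 0) = 0.
  by elim: {+}80%N l => [|n IH] [|x l] //=; rewrite IH mulr0.
by rewrite mulr1 addr0.
Qed.

Lemma invariant_value_initial M : (0 < size M)%N ->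
  invariant_value M (nth 0 (initial_values (size M))) =
  invariant_value M (sX T 0).
Proof.
move=> M0; rewrite /invariant_value; congr lsum; apply/eq_in_map => k _.
by rewrite initial_valuesE //; lia.
Qed.

Lemma recurrence_asymptotics (R : realType) :
  exists kappa lambda : R,
    [/\ 108269%:R / 10 ^+ 6 <= kappa < 108270%:R / 10 ^+ 6,
        4288630%:R / 10 ^+ 6 <= lambda < 4288631%:R / 10 ^+ 6 &
        zr R (sX T 0 n) / (kappa * lambda ^+ n) @[n --> \oo] --> (1 : R)].
Proof.
have k1_pos : (0 : R) < 108269%:R by rewrite ltr0n.
have M_pos : (0 : R) < 10 ^+ 6 by rewrite exprn_gt0.
have /andP[slo shi] := root_signs.
have [x [hx x0]] := ev_root R root_lo root_hi grid minimal_relation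
  isT isT isT slo shi.
(* The sign change was tested on [minimal_relation]; its multiple [relation] inherits the root. *)
have rx : ev R relation x = 0 by rewrite /relation ev_mul x0 mul0r.
have cvg := linear_recurrence_cvg R root_lo root_hi grid relation (sX T 0) x isT
  (fun n => annihilatesP relation n annihilates_relation) isT isT hx rx
  dominated_relation.
have small (n : nat) : zr R (zn n) = n%:R by exact: zr_nat.
(* Literals are cut into pieces of at most four digits to keep unary naturals small. *)
have zr_split (z : Z) (a b c : nat) : z = zn a * zn b + zn c ->
    zr R z = a%:R * b%:R + c%:R by move=> ->; rewrite zrD zrM !small.
have millionE : zr R million = 10 ^+ 6.
  by rewrite (zr_split _ 1000 1000 0); [ring | vm_compute].
have k1E : zr R 108269%ZZ = 108269%:R.
  by rewrite (zr_split _ 108 1000 269); [ring | vm_compute].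
have k2E : zr R 108270%ZZ = 108270%:R.
  by rewrite (zr_split _ 108 1000 270); [ring | vm_compute].
have l1E : zr R 4288630%ZZ = 4288630%:R.
  by rewrite (zr_split _ 4288 1000 630); [ring | vm_compute].
have l2E : zr R 4288631%ZZ = 4288631%:R.
  by rewrite (zr_split _ 4288 1000 631); [ring | vm_compute].
have pos l : ev_pos root_lo root_hi grid l -> 0 < ev R l x.
  exact: (ev_posP R root_lo root_hi grid l x isT isT hx).
have /and5P[/pos x_pos /pos x_lo /pos x_hi /pos den_pos] := limit_signs.
move=> /andP[/pos k_lo /pos k_hi].
have numE := esym (invariant_value_initial relation isT).
rewrite numE -/limit_num -/limit_den in cvg.
have comb (c d : Z) p q : 0 < ev R (ladd (lscale c p) (lscale d q)) x ->
    0 < zr R c * ev R p x + zr R d * ev R q x by rewrite ev_add !ev_scale.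
have line (c d : Z) : 0 < ev R [:: c; d] x -> 0 < zr R d * x + zr R c.
  by rewrite !ev_cons /ev /= mul0r add0r.
move/comb in k_lo; move/comb in k_hi.
move/line in x_pos; move/line in x_lo; move/line in x_hi.
have zN (z : Z) : zr R (- z) = - zr R z by exact: zrN.
rewrite (zN 108269%ZZ) k1E millionE in k_lo.
rewrite (zN million) k2E millionE in k_hi.
rewrite mul1r addr0 in x_pos.
rewrite (zN 4288630%ZZ) l1E millionE in x_lo.
rewrite (zN million) l2E millionE in x_hi.
exact: (asymptotic_constants _ _ _ _ _ _ _ _ _ _
  k1_pos M_pos x_pos x_lo x_hi den_pos k_lo k_hi cvg).
Qed.

End Asymptotics.

(** * Codes: sequences of columns *)

Definition shape : Type := (nat * nat * nat)%type.
Definition col : Type := (int * shape)%type.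

Definition area (s : shape) : nat := (s.1.1 + s.2)%N.
Definition span (s : shape) : nat := (s.1.1 + s.1.2 + s.2)%N.
Definition wf (s : shape) : bool := wf_shape s.1.1 s.1.2 s.2.

(* Row j of a column is adjacent to rows j and j - 1 of the column to its
   right; [meets C q k] says that the run of rows q, ..., q + k - 1 to the
   right of C is adjacent to C. *)
Definition meets (C : col) (q : int) (k : nat) : bool :=
  let: (p, (a, g, b)) := C in
  ((q < p + a%:Z) && (p <= q + k%:Z)) ||
  [&& (0 < b)%N, q < p + (a + g + b)%N%:Z & p + (a + g)%N%:Z <= q + k%:Z].

Definition link (C D : col) : bool :=
  let: (q, (c, h, d)) := D in
  meets C q c && ((d == 0%N) || meets C (q + (c + h)%N%:Z) d).

(** The lower run of [s] can touch C only from one of these [span C.2 + s.1.1] starting rows. *)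
Definition positions (C : col) (s : shape) : seq int :=
  [seq q <- [seq C.1 - s.1.1%:Z + i%:Z | i <- iota 0 (span C.2 + s.1.1)]
  | link C (q, s)].

Definition shapes (n : nat) : seq shape :=
  [seq (k, 0, 0)%N | k <- iota 1 n] ++
  [seq (ch.2, ch.1, d) | ch <- [seq (h, c) | h <- iota 1 3, c <- iota 1 n],
                         d <- iota 1 (n - ch.2)].

Definition next_columns (n : nat) (C : col) : seq col :=
  [seq (q, s) | s <- shapes n, q <- positions C s].

(** The fuel bounds the number of columns; as each has at least one cell, n units suffice. *)
Fixpoint extensions (fuel n : nat) (C : col) : seq (seq col) :=
  if n == 0%N then [:: [::]] else
  if fuel is m.+1 then
    [seq D :: l | D <- next_columns n C, l <- extensions m (n - area D.2) D]
  else [::].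

(** Placing the first column at row 0 selects one representative of each translation class. *)
Definition codes (n : nat) : seq (seq col) :=
  [seq C :: l | C <- [seq (0, (k, 0, 0)%N) | k <- iota 1 n],
                l <- extensions n (n - area C.2) C].

Lemma mem_gap_bottom n h c :
  ((h, c) \in [seq (h, c) | h <- iota 1 3, c <- iota 1 n]) =
  [&& 0 < h, h <= 3, 0 < c & c <= n]%N.
Proof.
apply/allpairsP/idP => [[[h' c']] |hc].
  by rewrite !mem_iota /= => -[+ + [-> ->]]; lia.
by exists (h, c); rewrite !mem_iota /=; split => //; lia.
Qed.

Lemma mem_shapes n s : (s \in shapes n) = wf s && (area s <= n)%N.
Proof.
case: s => [[a g] b]; rewrite /shapes mem_cat /wf /wf_shape /area /=.
apply/orP/idP.
  case=> [/mapP[k]|/allpairsPdep[[h c] [d []]]].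
    by rewrite mem_iota => + [-> -> ->]; lia.
  by rewrite mem_gap_bottom mem_iota /= => ? ? [-> -> ->]; lia.
move=> /andP[/andP[a0 /orP[/andP[/eqP -> /eqP ->]|/and3P[g0 g3 b0]]] an].
  by left; apply/mapP; exists a => //; rewrite mem_iota; lia.
right; apply/allpairsPdep; exists (g, a), b; rewrite mem_gap_bottom mem_iota /=.
by split=> //; lia.
Qed.

Lemma uniq_shapes n : uniq (shapes n).
Proof.
rewrite cat_uniq map_inj_uniq ?iota_uniq //; last by move=> k k' [].
rewrite andTb; apply/andP; split; last first.
  apply: allpairs_uniq_dep => [|x _|]; rewrite ?iota_uniq //.
    by apply: allpairs_uniq; rewrite ?iota_uniq // => -[? ?] [? ?] _ _ [-> ->].
  by move=> [[h c] d] [[h' c'] d'] _ _ /= [-> -> ->].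
apply/hasPn => s /allpairsPdep[[h c] [d [+ + ->]]].
rewrite mem_gap_bottom mem_iota /= => ? ?; apply/negP => /mapP[k _ [_ ? _]]; lia.
Qed.

Lemma mem_positions C s q : (q \in positions C s) = link C (q, s).
Proof.
rewrite mem_filter andb_idr //; case: C s => [p [[a g] b]] [[c h] d] /= /andP[+ _].
move=> lk; apply/mapP; exists `|(q - (p - c%:Z))%R|%N; last by move: lk; lia.
by rewrite mem_iota /span /=; move: lk; lia.
Qed.

Lemma uniq_positions C s : uniq (positions C s).
Proof.
by rewrite filter_uniq // map_inj_uniq ?iota_uniq // => i j; lia.
Qed.

Lemma mem_next_columns n C D :
  (D \in next_columns n C) = [&& wf D.2, (area D.2 <= n)%N & link C D].
Proof.
case: D => [q s]; rewrite andbA -mem_shapes -mem_positions.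
apply/allpairsPdep/andP => [[s' [q' [? ? [-> ->]]]] //|[? ?]].
by exists s, q.
Qed.

Lemma uniq_next_columns n C : uniq (next_columns n C).
Proof.
apply: allpairs_uniq_dep => [|s _|]; rewrite ?uniq_shapes ?uniq_positions //.
by move=> [s q] [s' q'] _ _ /= [-> ->].
Qed.

Definition total_area (l : seq col) : nat := sumn [seq area C.2 | C <- l].

Lemma wf_area s : wf s -> (0 < area s)%N.
Proof. by rewrite /wf /wf_shape /area; lia. Qed.

Lemma mem_extensions m n C l : (n <= m)%N ->
  (l \in extensions m n C) =
  [&& all (fun D => wf D.2) l, path link C l & total_area l == n].
Proof.
elim: m n C l => [|m IH] n C l nm.
  have -> : n = 0%N by lia.
  rewrite inE; case: l => [//|D l] /=; apply/esym/negP.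
  by case/and3P => /andP[/wf_area ? _] _; rewrite /total_area /=; lia.
rewrite /=; case: eqP => [->|n0].
  rewrite inE; case: l => [//|D l] /=; apply/esym/negP.
  by case/and3P => /andP[/wf_area ? _] _; rewrite /total_area /=; lia.
apply/allpairsPdep/idP => [[D [l' [+ + ->]]]|].
  move: (D : col) (l' : seq col) => {l'}{}[q s] l'.
  rewrite mem_next_columns => /and3P[/= ws sn lD].
  have s0 := wf_area _ ws.
  have ns : (n - area s <= m)%N by lia.
  rewrite IH //= ws lD => /and3P[-> -> /eqP al].
  by rewrite /total_area /= -[sumn _]/(total_area l') al subnKC.
case: l => [|D l]; first by rewrite /total_area /=; lia.
case: D => [q s] /and3P[/= /andP[ws wl] /andP[lD pl]].
rewrite /total_area /= -[sumn _]/(total_area l) => /eqP al.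
have s0 := wf_area _ ws.
have ns : (n - area s <= m)%N by lia.
exists (q, s), l; rewrite mem_next_columns /= ws lD IH // wl pl -al addKn eqxx.
by rewrite leq_addr.
Qed.

Lemma uniq_extensions m n C : uniq (extensions m n C).
Proof.
elim: m n C => [|m IH] n C /=; first by case: ifP.
case: ifP => // _; apply: allpairs_uniq_dep => [|D _|].
- exact: uniq_next_columns.
- exact: IH.
by move=> [D l] [D' l'] _ _ /= [-> ->].
Qed.

Lemma mem_codes n l :
  (l \in codes n) = if l is C :: l' then
    [&& C.1 == 0, C.2.1.2 == 0%N, all (fun D => wf D.2) l, path link C l' &
        total_area l == n] else false.
Proof.
apply/allpairsPdep/idP => [[C [l' [/mapP[k +] -> + ->]]]|].
  rewrite mem_iota => kn; rewrite mem_extensions; last by rewrite /area /=; lia.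
  case/and3P => wl pl al /=; rewrite wl pl /wf /wf_shape /=.
  by move: al; rewrite /total_area /area /=; lia.
case: l => [//|[p [[a g] b]] l'] /= /and5P[/eqP -> /eqP -> /andP[wC wl] pl al].
have b0 : b = 0%N by move: wC; rewrite /wf /wf_shape /=; lia.
subst b; have a0 := wf_area _ wC.
move: al a0; rewrite /total_area /area /= addn0 -[sumn _]/(total_area l').
move=> /eqP al a0; exists (0, (a, 0, 0)%N), l'; split=> //.
  by apply/mapP; exists a => //; rewrite mem_iota; lia.
have an : (n - a <= n)%N by lia.
by rewrite mem_extensions /area /= addn0 // wl pl -al addKn eqxx.
Qed.

Lemma uniq_codes n : uniq (codes n).
Proof.
apply: allpairs_uniq_dep => [|C _|]; rewrite ?uniq_extensions //.
  by rewrite map_inj_uniq ?iota_uniq // => i j [].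
by move=> [D l] [D' l'] _ _ /= [-> ->].
Qed.

(** * Counting the positions of the next column *)

Lemma count_interval x y N :
  count (fun i => (x <= i < y)%N) (iota 0 N) = (minn y N - x)%N.
Proof.
by elim: N => [|N IH]; rewrite ?minn0 // -addn1 iotaD count_cat IH /=; lia.
Qed.

Lemma count_split (A B C : pred nat) s :
  (forall i, (A i : nat) = (B i + C i)%N) -> count A s = (count B s + count C s)%N.
Proof. by move=> h; elim: s => //= i s ->; rewrite h; lia. Qed.

(** A run of k cells is adjacent to k + 1 rows of the column on its left. It therefore meets the
    hull of that column in span + k positions, and in g - k of them (none if k >= g) all these rows
    fall into the gap. *)
Lemma size_positions1 C k : wf C.2 -> (0 < k)%N ->
  zn (size (positions C (k, 0, 0)%N)) = zn (span C.2 + k) - zn (C.2.1.2 - k).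
Proof.
case: C => [p [[a g] b]]; rewrite /wf /wf_shape /span /= => wC k0.
rewrite size_filter count_map.
set N := (a + g + b + k)%N.
set P := preim _ _.
have PE i : (i < N)%N -> P i = ~~ (a + k <= i < a + g)%N.
  rewrite /P /N /=; lia.
pose E i := ((a + k)%N <= i < (a + g)%N)%N.
have -> : count P (iota 0 N) = count (predC E) (iota 0 N).
  by apply: eq_in_count => i; rewrite mem_iota => /PE.
have := count_predC E (iota 0 N); rewrite size_iota count_interval /N; lia.
Qed.

(** [W] describes the positions where both runs meet the hull of the column, [E] and [F] those where
    the lower, respectively the upper, run falls into the gap. The last two exclude each other:
    together the runs and their hole face c + h + d + 1 >= 4 rows, and g <= 3. *)
Lemma size_positions2 C c h d : wf C.2 -> wf (c, h, d) -> (0 < h)%N ->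
  zn (size (positions C (c, h, d))) =
  zn (span C.2 - h) - zn (C.2.1.2 - c - (h - C.2.2))
    - zn (C.2.1.2 - d - (h - C.2.1.1)).
Proof.
case: C => [p [[a g] b]]; rewrite /wf /wf_shape /span /= => wC wS h0.
rewrite size_filter count_map.
set N := (a + g + b + c)%N.
set P := preim _ _.
pose W i := (0 <= i < (a + g + b - h))%N.
pose E i := ((a + c)%N <= i < minn (a + g) (a + g + b - h))%N.
pose F i := ((a - h)%N <= i < (a + g - h - d))%N.
have PE i : (i < N)%N -> P i = [&& W i, ~~ E i & ~~ F i].
  rewrite /P /N /W /E /F /=; lia.
pose P' i := [&& W i, ~~ E i & ~~ F i].
have -> : count P (iota 0 N) = count P' (iota 0 N).
  by apply: eq_in_count => i; rewrite mem_iota => /PE.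
have h1 : count W (iota 0 N) =
    (count (fun i => W i && ~~ E i) (iota 0 N) + count E (iota 0 N))%N.
  by apply: count_split => i; rewrite /W /E; lia.
have h2 : count (fun i => W i && ~~ E i) (iota 0 N) =
    (count P' (iota 0 N) + count F (iota 0 N))%N.
  by apply: count_split => i; rewrite /P' /W /E /F; lia.
have eW : minn (a + g + b - h) N = (a + g + b - h)%N by rewrite /N; lia.
have eE : minn (minn (a + g) (a + g + b - h)) N = minn (a + g) (a + g + b - h).
  by rewrite /N; lia.
have eF : minn (a + g - h - d) N = (a + g - h - d)%N by rewrite /N; lia.
have sE : (minn (a + g) (a + g + b - h) - (a + c) = g - c - (h - b))%N.
  by clear; case: (leqP h b) => hb; rewrite /minn; case: ltnP; lia.
have sF : (a + g - h - d - (a - h) = g - d - (h - a))%N.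
  by clear; case: (leqP h a) => hb; lia.
move: h2 h1; rewrite !count_interval eW eE eF sE sF subn0 => ->.
clear; lia.
Qed.

Lemma size_positions_shift p s s' :
  size (positions (p, s) s') = size (positions (0, s) s').
Proof.
case: s s' => [[a g] b] [[c h] d]; rewrite !size_filter !count_map.
by apply: eq_count => i /=; lia.
Qed.

Definition extension_count (n : nat) (s : shape) : nat :=
  size (extensions n n (0, s)).

Lemma size_extensions_step m n p s :
  (forall s' q, wf s' -> size (extensions m (n.+1 - area s') (q, s')) =
     extension_count (n.+1 - area s') s') ->
  size (extensions m.+1 n.+1 (p, s)) = (\sum_(s' <- shapes n.+1)
    size (positions (0%R, s) s') * extension_count (n.+1 - area s') s')%N.
Proof.
move=> IH; rewrite /= size_allpairs_dep sumnE big_map.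
rewrite (big_allpairs_dep (op := addn)) /=.
rewrite [LHS]big_seq [RHS]big_seq; apply: eq_bigr => s' /=.
rewrite mem_shapes => /andP[ws _].
under eq_bigr do rewrite IH //.
by rewrite big_const_seq count_predT iter_addn_0 size_positions_shift mulnC.
Qed.

(** Neither surplus fuel nor the height of the last column matters, which justifies the
    normalisation in [extension_count]. *)
Lemma size_extensions m n p s : (n <= m)%N ->
  size (extensions m n (p, s)) = extension_count n s.
Proof.
elim/ltn_ind: n m p s => -[|n] IH m p s nm; first by case: m nm.
case: m nm => // m nm; rewrite /extension_count !size_extensions_step //.
all: by move=> s' q /wf_area s0; apply: IH; lia.
Qed.

Lemma extension_countS n s :
  extension_count n.+1 s = (\sum_(s' <- shapes n.+1)
    size (positions (0%R, s) s') * extension_count (n.+1 - area s') s')%N.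
Proof.
apply: size_extensions_step => s' q /wf_area s0.
by apply: size_extensions; lia.
Qed.

Definition T_count (n a g b : nat) : Z := zn (extension_count n (a, g, b)).

Lemma znM (x y : nat) : zn (x * y)%N = zn x * zn y.
Proof. by lia. Qed.

Lemma zn_sum (I : Type) (s : seq I) (F : I -> nat) :
  zn (\sum_(i <- s) F i)%N = \sum_(i <- s) zn (F i).
Proof.
by elim: s => [|i s IH]; rewrite ?big_nil // !big_cons -IH; lia.
Qed.

Lemma iota_diag_sum n (F : nat -> Z) (f : nat -> nat -> Z) :
  (forall k, (0 < k)%N -> (k <= n)%N -> F k = f (n - k)%N k) ->
  \sum_(k <- iota 1 n) F k = diag_sum f n.
Proof.
move=> Ff; rewrite -[iota 1 n]/(iota (1 + 0) n) iotaDl big_map.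
have -> : iota 0 n = index_iota 0 n by rewrite /index_iota subn0.
rewrite big_mkord; apply: eq_bigr => k _; have := ltn_ord k => kn.
by rewrite Ff; [congr (f _ _) | |]; lia.
Qed.

Lemma sum_shapes n (F : shape -> Z) :
  \sum_(s <- shapes n) F s = \sum_(k <- iota 1 n) F (k, 0, 0)%N +
    \sum_(h <- iota 1 3) \sum_(c <- iota 1 n) \sum_(d <- iota 1 (n - c))
      F (c, h, d).
Proof.
rewrite /shapes big_cat big_map; congr (_ + _).
by rewrite [LHS]big_allpairs_dep big_allpairs_dep.
Qed.

Lemma T_count_rec : shape_recurrence T_count.
Proof.
move=> n a g b wC; case: n => [|n].
  by rewrite diag_sum0 big1 // => h _; rewrite diag_sum0.
rewrite {1}/T_count extension_countS zn_sum sum_shapes add0r.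
congr (_ + _).
  apply: iota_diag_sum => k k0 kn.
  rewrite znM size_positions1 // /T_count /area /= addn0 -?/(span _).
  by [].
rewrite -[iota 1 3]/(index_iota 1 4) big_add1 big_mkord.
apply: eq_bigr => h _; apply: iota_diag_sum => c c0 cn.
apply: iota_diag_sum => d d0 dn; rewrite /= in dn *.
have wS : wf (c, h.+1, d).
  by rewrite /wf /wf_shape /= c0 d0 (ltn_ord h).
rewrite znM size_positions2 //.
by rewrite /T_count /span /area /= subnDA.
Qed.

Lemma size_codes n : zn (size (codes n)) = sX T_count 0 n.
Proof.
rewrite /codes size_allpairs_dep sumnE !big_map zn_sum /sX.
apply: iota_diag_sum => k k0 kn.
by rewrite size_extensions ?leq_subr // /T_count /area /= !addn0.
Qed.

(** * Runs and columns in the hexagonal tiling *)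

Lemma share_edgeE (i x j y : int) : share_edge (i, x) (j, y) =
  [|| (j == i) && ((y == x + 1) || (y == x - 1)),
      (j == i + 1) && ((y == x) || (y == x - 1)) |
      (j == i - 1) && ((y == x) || (y == x + 1))].
Proof. by rewrite /share_edge !inE !xpair_eqE /=; lia. Qed.

Lemma share_edge_sym : symmetric share_edge.
Proof. by move=> [i x] [j y]; rewrite !share_edgeE; lia. Qed.

Definition joined (A : {fset cell}) (c d : cell) : Prop :=
  exists p : seq cell, [/\ path share_edge c p, {subset p <= A} & last c p = d].

Lemma joined_refl A c : joined A c c.
Proof. by exists [::]. Qed.

Lemma joined_trans A c d e : joined A c d -> joined A d e -> joined A c e.
Proof.
move=> [p [pp pA <-]] [q [qp qA <-]]; exists (p ++ q).
rewrite cat_path pp qp last_cat; split => // z; rewrite mem_cat.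
by case/orP; [exact: pA | exact: qA].
Qed.

Lemma joined_edge (A : {fset cell}) c d : share_edge c d -> d \in A -> joined A c d.
Proof.
by move=> cd dA; exists [:: d]; rewrite /= cd; split => // z; rewrite inE => /eqP ->.
Qed.

Lemma joined_sym (A : {fset cell}) c d : c \in A -> joined A c d -> joined A d c.
Proof.
move=> + [p]; elim: p c => [|e p IH] c cA [/= pp pA pd].
  by rewrite pd; exact: joined_refl.
case/andP: pp => ce pp.
have eA : e \in A by apply: pA; rewrite inE eqxx.
apply: (joined_trans _ _ e).
  by apply: IH => //; split => // z zp; apply: pA; rewrite inE zp orbT.
by apply: joined_edge; rewrite // share_edge_sym.
Qed.

Lemma joined_sub (A B : {fset cell}) c d : A `<=` B -> joined A c d -> joined B c d.
Proof.
move=> /fsubsetP AB [p [pp pA pd]]; exists p; split => // z /pA; exact: AB.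
Qed.

Definition in_stack (i : int) (A : {fset cell}) : Prop :=
  forall c, c \in A -> c.1 = i.

(** A discrete intermediate value argument: a step inside a stack changes the height by exactly
    one. *)
Lemma connected_convex i A x y z : in_stack i A -> connected_cells A ->
  (i, x) \in A -> (i, y) \in A -> x <= z <= y -> (i, z) \in A.
Proof.
move=> Ai cA xA yA /andP[xz zy].
have [p [pp pA pl]] := cA _ _ xA yA.
have : z <= (last (i, x) p).2 by rewrite pl.
have : (i, x).2 <= z by [].
elim: p (i, x) xA pp pA {pl} => [|[j' w'] p IH] [j w] cA'.
  move=> _ _ /= h1 h2; have -> : z = w by lia.
  by have /= <- := Ai _ cA'.
have /= ej := Ai _ cA'; subst j; case/andP => cd pp pA cz zl.
have dA : (j', w') \in A by apply: pA; rewrite inE eqxx.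
have /= ej := Ai _ dA; subst j'.
have [<-//|wz] := eqVneq w z.
apply: (IH (i, w')) => //; first by move=> e ep; apply: pA; rewrite inE ep orbT.
by move: cd; rewrite share_edgeE /=; lia.
Qed.

Lemma joined_up (A : {fset cell}) i x n :
  (forall t, (t <= n)%N -> (i, x + t%:Z) \in A) -> joined A (i, x) (i, x + n%:Z).
Proof.
elim: n => [|n IH] hA; first by rewrite addr0; exact: joined_refl.
apply: (joined_trans _ _ (i, x + n%:Z)).
  by apply: IH => t tn; apply: hA; exact: leqW.
by apply: joined_edge (hA _ _) => //; rewrite share_edgeE; lia.
Qed.

Lemma convex_connected i (A : {fset cell}) : in_stack i A ->
  (forall x y z, (i, x) \in A -> (i, y) \in A -> x <= z <= y -> (i, z) \in A) ->
  connected_cells A.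
Proof.
move=> Ai cvx.
have up x y : (i, x) \in A -> (i, y) \in A -> x <= y -> joined A (i, x) (i, y).
  move=> xA yA xy; have -> : y = x + `|(y - x)%R|%N%:Z by lia.
  by apply: joined_up => t tn; apply: (cvx x y) => //; lia.
move=> [i' x] [j y] xA yA; move: (Ai _ xA) (Ai _ yA) => /= ei ej; subst i' j.
have [xy|/ltW yx] := leP x y; first exact: up.
by apply: joined_sym; [|exact: up].
Qed.

Definition run (i l : int) (k : nat) : {fset cell} :=
  [fset ((i, l + t%:Z) : cell) | t in iota 0 k].

Lemma in_run i l k c : (c \in run i l k) = (c.1 == i) && (l <= c.2 < l + k%:Z).
Proof.
apply/imfsetP/idP => [[t /= + ->]|].
  by rewrite mem_iota eqxx /=; lia.
case: c => j x /= /andP[/eqP -> lx]; exists `|(x - l)%R|%N.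
  by rewrite /= mem_iota; lia.
by congr pair; lia.
Qed.

Lemma run_connected i l k : connected_cells (run i l k).
Proof.
apply: (convex_connected i) => [c|x y z]; rewrite !in_run.
  by case/andP => /eqP.
by rewrite /= eqxx /=; lia.
Qed.

Lemma mem_components A K : K \in components A <-> is_component A K.
Proof.
rewrite /components !inE /= -[_ \in mem_seq _]/(K \in fpowerset A) fpowersetE.
split; first by case/andP => _ /asboolP.
by move=> cK; apply/andP; split; [case: cK | apply/asboolP].
Qed.

Lemma run_component i (A : {fset cell}) l k : in_stack i A -> (0 < k)%N ->
  run i l k `<=` A -> (i, l - 1) \notin A -> (i, l + k%:Z) \notin A ->
  is_component A (run i l k).
Proof.
move=> Ai k0 rA lA kA; split=> //; last first.
- move=> K' rK KA cK; apply/eqP; rewrite eqEfsubset rK andbT.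
  have Ki : in_stack i K' by move=> c /(fsubsetP KA); exact: Ai.
  apply/fsubsetP => -[j x] xK; have /= ej := Ki _ xK; subst j.
  have lK : (i, l) \in K' by apply: (fsubsetP rK); rewrite in_run /=; lia.
  rewrite in_run /= eqxx /=; apply/negPn/negP => hx.
  have [xl|lx] := ltP x l.
    move/negP: lA; apply; apply: (fsubsetP KA).
    by apply: (connected_convex i K' x l) => //; lia.
  move/negP: kA; apply; apply: (fsubsetP KA).
  by apply: (connected_convex i K' l x) => //; lia.
- exact: run_connected.
by apply/fset0Pn; exists (i, l); rewrite in_run /=; lia.
Qed.

Lemma component_of_run i (A K : {fset cell}) l k x : in_stack i A ->
  is_component A K -> run i l k `<=` A -> (i, l - 1) \notin A ->
  (i, l + k%:Z) \notin A -> (i, x) \in K -> (i, x) \in run i l k ->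
  K = run i l k.
Proof.
move=> Ai [K0 KA cK mK] rA lA kA xK; rewrite in_run /= eqxx /= => lx.
apply/esym; apply: mK => //; last exact: run_connected.
have Ki : in_stack i K by move=> c /(fsubsetP KA); exact: Ai.
apply/fsubsetP => -[j y] yK; have /= ej := Ki _ yK; subst j.
rewrite in_run /= eqxx /=; apply/negPn/negP => hy.
have [yl|ly] := ltP y l.
  move/negP: lA; apply; apply: (fsubsetP KA).
  by apply: (connected_convex i K y x) => //; lia.
move/negP: kA; apply; apply: (fsubsetP KA).
by apply: (connected_convex i K x y) => //; lia.
Qed.

Definition rows (C : col) (j : int) : bool :=
  let: (p, (a, g, b)) := C in
  (p <= j < p + a%:Z) || (p + (a + g)%N%:Z <= j < p + (a + g + b)%N%:Z).

Lemma cells_bounded (A : {fset cell}) :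
  exists M : nat, forall c, c \in A -> (`|c.2| <= M)%N.
Proof.
exists (\max_(c <- enum_fset A) `|c.2|%N) => c cA.
by apply: (leq_bigmax_seq (F := fun c : cell => `|c.2|%N)).
Qed.

Lemma next_above i (A : {fset cell}) l x : (i, x) \in A -> l <= x ->
  exists q, [/\ l <= q, (i, q) \in A & forall y, l <= y < q -> (i, y) \notin A].
Proof.
move=> xA lx; pose P (t : nat) := (i, l + t%:Z) \in A.
have exP : exists t, P t.
  by exists `|(x - l)%R|%N; rewrite /P; have -> : l + `|(x - l)%R|%N = x by lia.
case: (ex_minnP exP) => t Pt tmin; exists (l + t%:Z); split=> //; first by lia.
move=> y ly; apply/negP => yA.
have : P `|(y - l)%R|%N.
  by rewrite /P; have -> : l + `|(y - l)%R|%N = y by lia.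
by move/tmin; lia.
Qed.

Lemma run_from i (A : {fset cell}) l : (i, l) \in A ->
  exists k, [/\ (0 < k)%N, run i l k `<=` A & (i, l + k%:Z) \notin A].
Proof.
move=> lA; have [M hM] := cells_bounded A.
pose P (t : nat) := (i, l + t%:Z) \notin A.
have exP : exists t, P t.
  exists (`|l| + M).+1; apply/negP => /hM /=; lia.
case: (ex_minnP exP) => t Pt tmin; exists t; split=> //.
  by rewrite lt0n; apply/eqP => t0; move: Pt; rewrite t0 /P addr0 lA.
apply/fsubsetP => -[j x]; rewrite in_run /= => /andP[/eqP -> lx].
apply/negPn/negP => xA; have : P `|(x - l)%R|%N.
  by rewrite /P; have -> : l + `|(x - l)%R|%N = x by lia.
by move/tmin; lia.
Qed.

Lemma column_components i (A K : {fset cell}) p a g b : in_stack i A ->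
  wf (a, g, b) -> (forall j, ((i, j) \in A) = rows (p, (a, g, b)) j) ->
  is_component A K <->
  K = run i p a \/ (0 < b)%N /\ K = run i (p + (a + g)%N%:Z) b.
Proof.
rewrite /wf /wf_shape /= => Ai wC hA.
have sub l k : (forall j, l <= j < l + k%:Z -> rows (p, (a, g, b)) j) -> run i l k `<=` A.
  move=> h; apply/fsubsetP => -[j x]; rewrite in_run /= => /andP[/eqP -> lx].
  by rewrite hA; exact: h.
have s1 : run i p a `<=` A by apply: sub => j; rewrite /=; lia.
have s2 : run i (p + (a + g)%N%:Z) b `<=` A by apply: sub => j; rewrite /=; lia.
split=> [cK|]; last first.
  case=> [->|[b0 ->]]; apply: run_component => //; rewrite ?hA /=; lia.
have [/fset0Pn[[j x] xK] KA _ _] := cK.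
have /= ej := Ai _ (fsubsetP KA _ xK); subst j.
have := fsubsetP KA _ xK; rewrite hA /= => /orP[hx|hx]; [left|right; split; first by lia].
  by apply: (component_of_run i A K p a x) => //; rewrite ?hA ?in_run /=; lia.
by apply: (component_of_run i A K _ b x) => //; rewrite ?hA ?in_run /=; lia.
Qed.

Lemma gapE i l k q n : (0 < k)%N -> (0 < n)%N -> l + k%:Z <= q ->
  gap i (run i l k) (run i q n) = [set c | c.1 = i /\ l + k%:Z <= c.2 < q]%classic.
Proof.
move=> k0 n0 lq; apply/seteqP; split => -[j x] [/= -> h]; split=> //.
  have := h (i, l + (k.-1)%:Z) (i, q); rewrite !in_run /= eqxx /=; lia.
by move=> [? u] [? v]; rewrite !in_run /=; lia.
Qed.

Lemma card_gap i (l : int) (g m : nat) :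
  ([set c : cell | c.1 = i /\ l <= c.2 < l + g%:Z]%classic #<= `I_m)%card =
  (g <= m)%N.
Proof.
rewrite -card_le_II.
have e : ([set c : cell | c.1 = i /\ l <= c.2 < l + g%:Z]%classic #= `I_g)%card.
  apply/card_set_bijP; exists (fun c : cell => `|(c.2 - l)%R|%N); split.
  - by move=> [j x] /= [_ h]; lia.
  - move=> [j x] [k y]; rewrite !inE /= => -[-> hx] [-> hy] h; congr pair; lia.
  - by move=> t /= tg; exists (i, l + t%:Z) => /=; [split=> //; lia | lia].
by rewrite (card_le_eql e).
Qed.

Lemma run_neq i l k l' k' : (0 < k)%N -> l + k%:Z <= l' -> run i l k != run i l' k'.
Proof.
move=> k0 ll; apply/eqP => /fsetP /(_ (i, l)); rewrite !in_run /= eqxx /=; lia.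
Qed.

Lemma next_run i (A : {fset cell}) l x : in_stack i A -> (i, l) \notin A ->
  (i, x) \in A -> l <= x ->
  exists q k, [/\ l < q, (0 < k)%N, run i q k \in components A,
    forall j, q <= j < q + k%:Z -> (i, j) \in A &
    (i, q + k%:Z) \notin A /\ forall j, l <= j < q -> (i, j) \notin A].
Proof.
move=> Ai lA xA lx; have [q [lq qA qmin]] := next_above i A _ _ xA lx.
have {}lq : l < q.
  by rewrite lt_neqAle lq andbT; apply: contraNneq lA => ->.
have [k [k0 RA kA]] := run_from i A q qA; exists q, k; split=> //.
- apply/mem_components/(run_component i A q k Ai k0 RA _ kA).
  by apply: qmin; clear -lq; lia.
- by move=> j qj; apply: (fsubsetP RA); rewrite in_run /= eqxx.
Qed.

(** Scanning upwards from below all cells finds a first run and possibly a second; a cell above the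
    second would start a third component. The hole between the two runs is their gap, whence g <=
    3. *)
Lemma cheesy_column i (A : {fset cell}) : in_stack i A -> A != fset0 ->
  (#|` components A| <= 2)%N ->
  (forall K L, K \in components A -> L \in components A -> K != L ->
     (gap i K L #<= `I_3)%card) ->
  exists C : col, wf C.2 /\ forall j, ((i, j) \in A) = rows C j.
Proof.
move=> Ai /fset0Pn[[i' x0] x0A] card2 gap3; have /= ei := Ai _ x0A; subst i'.
have [M hM] := cells_bounded A.
have low y : y < - M%:Z -> (i, y) \notin A.
  by move=> yM; apply/negP => /hM /=; clear -yM; lia.
have x0M : - M.+1%:Z <= x0 by have /= := hM _ x0A; clear; lia.
have lM : (i, - M.+1%:Z) \notin A by apply: low; clear; lia.
have {x0A x0M lM} [p [a [_ a0 cR1 R1A [aA pmin]]]] := next_run i A _ _ Ai lM x0A x0M.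
have {hM low pmin} plow y : y < p -> (i, y) \notin A.
  move=> yp; have [yM|My] := ltP y (- M%:Z); first exact: low.
  by apply: pmin; clear -yp My; lia.
have [[x [px xA]]|no2] := pselect (exists x, p + a%:Z <= x /\ (i, x) \in A); last first.
  exists (p, (a, 0, 0)%N); split; first by rewrite /wf /wf_shape /= a0.
  move=> j; apply/idP/idP => [jA|pj]; last by apply: R1A; clear -pj; move: pj => /=; lia.
  have [jp|pj] := ltP j p; first by move: (plow _ jp); rewrite jA.
  have [pa|jpa] := leP (p + a%:Z) j; first by case: no2; exists j.
  by rewrite /= pj jpa.
have {x px xA} [q [b [paq b0 cR2 R2A [bA qmin]]]] := next_run i A _ _ Ai aA xA px.
have n12 := run_neq i p a q b a0 (ltW paq).
pose g := `|(q - (p + a%:Z))%R|%N.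
have qE : q = p + (a + g)%N%:Z by rewrite /g; clear -paq; lia.
have g0 : (0 < g)%N by clear -qE paq; lia.
have {gap3} g3 : (g <= 3)%N.
  have := gap3 _ _ cR1 cR2 n12; rewrite gapE ?(ltW paq) //.
  have -> : q = p + a%:Z + g%:Z by rewrite qE; clear; lia.
  by rewrite card_gap.
have top x : q + b%:Z <= x -> (i, x) \notin A.
  move=> qx; apply/negP => xA.
  have [r [d [qbr _ cR3 _ _]]] := next_run i A _ _ Ai bA xA qx.
  have : (run i p a |` [fset run i q b; run i r d] `<=` components A)%fset.
    by apply/fsubsetP => K; rewrite in_fset1U in_fset2 => /or3P[] /eqP ->.
  move/fsubset_leq_card => /leq_trans /(_ card2).
  have n23 := run_neq i q b r d b0 (ltW qbr).
  have n13 : run i p a != run i r d.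
    by apply: run_neq => //; clear -qbr paq; lia.
  by rewrite cardfsU1 in_fset2 cardfs2 (negPf n12) (negPf n13) n23.
exists (p, (a, g, b)); split; first by rewrite /wf /wf_shape /= a0 g0 g3 b0 orbT.
move=> j; apply/idP/idP => [jA|/= /orP[pj|qj]]; first last.
- by apply: R2A; move: qj; rewrite qE; clear; lia.
- exact: R1A.
have [jp|pj] := ltP j p; first by move: (plow _ jp); rewrite jA.
have [qbj|jqb] := leP (q + b%:Z) j; first by move: (top _ qbj); rewrite jA.
have [paj|jpa] := leP (p + a%:Z) j; last by rewrite /= pj jpa.
have [qj|jq] := leP q j; last by move: (qmin j); rewrite paj jq jA => /(_ isT).
by move: qj jqb; rewrite qE /=; clear; lia.
Qed.

Definition is_run (D : col) (q : int) (n : nat) : Prop :=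
  let: (p, (a, g, b)) := D in
  q = p /\ n = a \/ [/\ (0 < b)%N, q = p + (a + g)%N%:Z & n = b].

Lemma is_run_gt0 D q n : wf D.2 -> is_run D q n -> (0 < n)%N.
Proof.
case: D => [p [[a g] b]]; rewrite /wf /wf_shape /= => wD.
by case=> [[_ ->]|[b0 _ ->]] //; case/andP: wD.
Qed.

Lemma rowsP D x : rows D x <-> exists q n, is_run D q n /\ q <= x < q + n%:Z.
Proof.
case: D => [p [[a g] b]] /=; split.
  case/orP => hx; first by exists p, a; split=> //; left.
  by exists (p + (a + g)%N%:Z), b; split; [right; split=> //|]; lia.
by case=> q [n [[[-> ->]|[_ -> ->]]]]; lia.
Qed.

Lemma meetsP C q n : wf C.2 -> (0 < n)%N ->
  meets C q n <-> exists x y, [/\ q <= x < q + n%:Z, rows C y & y = x \/ y = x + 1].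
Proof.
case: C => [p [[a g] b]]; rewrite /wf /wf_shape /= => wC n0; split; last first.
  by case=> x [y [hx hy [e|e]]]; subst y; move: hx hy; clear -n0; lia.
have a0 : (0 < a)%N by case/andP: wC.
clear wC; case/orP => [/andP[h1 h2]|/and3P[b0 h1 h2]].
  (* The lower end of whichever interval starts higher provides the contact. *)
  have [pq|qp] := leP p q.
    by exists q, q; split; [clear -n0; lia|clear -pq h1; lia|left].
  exists (p - 1), p; split; [clear -qp h2; lia|clear -a0; lia|right; lia].
have [pq|qp] := leP (p + (a + g)%N%:Z) q.
  by exists q, q; split; [clear -n0; lia|clear -pq h1; lia|left].
exists (p + (a + g)%N%:Z - 1), (p + (a + g)%N%:Z).
by split; [clear -qp h2; lia|clear -b0; lia|right; lia].
Qed.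

Lemma linkP C D : wf C.2 -> wf D.2 ->
  link C D <-> forall q n, is_run D q n ->
    exists x y, [/\ q <= x < q + n%:Z, rows C y & y = x \/ y = x + 1].
Proof.
move=> wC wD; split.
  move=> lk q n rn; apply/meetsP => //; first exact: is_run_gt0 rn.
  case: D wD lk rn => [p [[a g] b]] wD /= /andP[ma mb].
  case=> [[-> ->]|[b0 -> ->]] //; case/orP: mb => // /eqP b1.
  by rewrite b1 in b0.
case: D wD => [p [[a g] b]] wD /= h; apply/andP; split.
  apply/meetsP => //; first by case/andP: wD.
  by apply: h; left.
have [//|] := eqVneq b 0%N; rewrite -lt0n => b0.
by apply/meetsP => //; apply: h; right.
Qed.

Lemma rows_low D : wf D.2 -> rows D D.1.
Proof. by case: D => [p [[a g] b]]; rewrite /wf /wf_shape /=; lia. Qed.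

Lemma in_column P i j x : ((j, x) \in column P i) = (j == i) && ((i, x) \in P).
Proof.
rewrite /column !inE /= andbC; have [->//|//] := eqVneq j i.
Qed.

Lemma column_in_stack P i : in_stack i (column P i).
Proof. by move=> [j x]; rewrite in_column => /andP[/eqP]. Qed.

Definition col0 : col := (0, (1, 0, 0)%N).

(** The range condition keeps the index inside [cs], so the default [col0] has no influence. *)
Definition layout (P : {fset cell}) (i : int) (cs : seq col) : Prop :=
  forall j x, ((j, x) \in P) =
    (i <= j < i + (size cs)%:Z) && rows (nth col0 cs `|(j - i)%R|) x.

Lemma gapC i K L : gap i K L = gap i L K.
Proof.
by apply/seteqP; split => c [ci h]; split => // a b aK bL; rewrite orbC; exact: h.
Qed.

Lemma component_run i P D K : wf D.2 ->
  (forall x, ((i, x) \in P) = rows D x) ->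
  K \in components (column P i) <-> exists q n, is_run D q n /\ K = run i q n.
Proof.
case: D => [p [[a g] b]] wD hP.
have h x : ((i, x) \in column P i) = rows (p, (a, g, b)) x.
  by rewrite in_column eqxx hP.
have cc := column_components i _ K _ _ _ _ (column_in_stack P i) wD h.
split.
  move=> /mem_components/cc [->|[b0 ->]]; first by exists p, a; split => //; left.
  by exists (p + (a + g)%N%:Z), b; split => //; right.
case=> q [n [rn ->]]; apply/mem_components.
apply: (column_components i _ _ _ _ _ _ (column_in_stack P i) wD h).2.
by case: rn => [[-> ->]|[b0 -> ->]]; [left|right].
Qed.

(** * Cheesy polyominoes and codes *)

Section LayoutCheesy.
Variables (P : {fset cell}) (i0 : int) (C : col) (l : seq col).
Hypothesis hP : layout P i0 (C :: l).
Hypothesis wfs : all (fun D => wf D.2) (C :: l).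
Hypothesis links : path link C l.
Hypothesis single : C.2.1.2 = 0%N.

Let N := size (C :: l).
Let col_at (t : nat) := nth col0 (C :: l) t.

Lemma col_at_wf t : (t < N)%N -> wf (col_at t).2.
Proof. by move=> tN; exact: (all_nthP col0 wfs). Qed.

Lemma layout_in t x : (t < N)%N -> ((i0 + t%:Z, x) \in P) = rows (col_at t) x.
Proof.
move=> tN; rewrite hP -/N.
have -> : i0 <= i0 + t%:Z < i0 + N%:Z by clear -tN; lia.
by have -> : `|(i0 + t%:Z - i0)%R|%N = t by clear; lia.
Qed.

Lemma layout_out j x : (j, x) \in P -> exists2 t, (t < N)%N & j = i0 + t%:Z.
Proof.
rewrite hP -/N => /andP[jN _]; exists `|(j - i0)%R|%N; clear -jN; lia.
Qed.

Lemma layout_index j : is_column_index P j <-> exists2 t, (t < N)%N & j = i0 + t%:Z.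
Proof.
split.
  case/fset0Pn => -[j' x]; rewrite in_column => /andP[_].
  exact: layout_out.
case=> t tN ->; apply/fset0Pn; exists (i0 + t%:Z, (col_at t).1).
by rewrite in_column eqxx /= layout_in // rows_low // col_at_wf.
Qed.

Lemma layout_touch t q n : (t.+1 < N)%N -> is_run (col_at t.+1) q n ->
  exists x y, [/\ q <= x < q + n%:Z, (i0 + t%:Z, y) \in P &
    share_edge (i0 + t.+1%:Z, x) (i0 + t%:Z, y)].
Proof.
move=> tN rn; have tN' := ltnW tN.
have lk : link (col_at t) (col_at t.+1).
  by have := (pathP col0 links) t tN; case: t tN {rn tN'}.
have [x [y [hx hy e]]] := (linkP _ _ (col_at_wf _ tN') (col_at_wf _ tN)).1 lk _ _ rn.
exists x, y; split=> //; first by rewrite layout_in.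
rewrite share_edgeE; clear -e; lia.
Qed.

Lemma layout_run t q n : (t < N)%N -> is_run (col_at t) q n ->
  run (i0 + t%:Z) q n `<=` P.
Proof.
move=> tN rn; apply/fsubsetP => -[j x]; rewrite in_run /= => /andP[/eqP -> hx].
by rewrite layout_in //; apply/rowsP; exists q, n.
Qed.

Lemma layout_first_connected : connected_cells (column P i0).
Proof.
have h x : ((i0, x) \in P) = rows C x.
  by rewrite -(layout_in 0) // addr0.
have /andP[+ _] := wfs.
move: h single; case: C => [p [[a g] b]] /= h e; subst g; rewrite /wf /wf_shape /=.
move=> wC; apply: (convex_connected i0); first exact: column_in_stack.
move=> x y z; rewrite !in_column eqxx /= !h; move: wC; clear; lia.
Qed.

(** Each run touches the preceding column, so every cell can be led back to the first column, which
    is connected. *)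
Lemma layout_joined t x : (t < N)%N -> (i0 + t%:Z, x) \in P ->
  joined P (i0 + t%:Z, x) (i0, C.1).
Proof.
elim: t x => [|t IH] x tN xP.
  rewrite addr0 in xP *; apply: (joined_sub (column P i0)).
    by apply/fsubsetP => -[j y]; rewrite in_column => /andP[/eqP ->].
  apply: layout_first_connected; rewrite in_column eqxx //=.
  by rewrite -[i0]addr0 (layout_in 0) // rows_low // (col_at_wf 0).
move: (xP); rewrite layout_in // => /rowsP[q [n [rn hx]]].
have [x' [y [hx' yP e]]] := layout_touch _ _ _ tN rn.
apply: (joined_trans _ _ (i0 + t.+1%:Z, x')).
  apply: (joined_sub _ _ _ _ (layout_run _ _ _ tN rn)).
  by apply: run_connected; rewrite in_run /= eqxx.
apply: (joined_trans _ _ (i0 + t%:Z, y)); first exact: joined_edge.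
by apply: IH => //; exact: ltnW.
Qed.

Lemma layout_cheesy : cheesy 3 P.
Proof.
split.
- split.
    apply/fset0Pn; exists (i0, C.1).
    by rewrite -[i0]addr0 (layout_in 0) // rows_low // (col_at_wf 0).
  move=> [j x] [k y] jP kP.
  have [t tN ej] := layout_out _ _ jP; have [s sN ek] := layout_out _ _ kP.
  subst j k; apply: (joined_trans _ _ (i0, C.1)); first exact: layout_joined.
  by apply: joined_sym => //; exact: layout_joined.
- split.
    move=> i [/layout_index[t tN ->] imin].
    have := imin i0; have -> : i0 + t%:Z <= i0 -> t = 0%N by clear; lia.
      by rewrite addr0 => _; exact: layout_first_connected.
    by apply: imin; apply/layout_index; exists 0%N; rewrite // addr0.
  move=> i k [/layout_index[t tN ei] /layout_index[s sN ek] ik nb] K; subst i k.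
  have es : s = t.+1.
    have [//|ne] := eqVneq s t.+1.
    have tN1 : (t.+1 < N)%N by clear -ne ik sN; lia.
    have /nb : is_column_index P (i0 + t.+1%:Z) by apply/layout_index; exists t.+1.
    by clear -ne ik; lia.
  subst s => /(component_run _ _ _ _ (col_at_wf _ sN) (fun x => layout_in _ x sN)).
  move=> [q [n [rn ->]]].
  have [x [y [hx yP e]]] := layout_touch _ _ _ sN rn.
  exists (i0 + t.+1%:Z, x), (i0 + t%:Z, y); split=> //.
    by rewrite in_run /= eqxx.
  by rewrite in_column eqxx.
- move=> i; have [/layout_index[t tN ->]|] := boolP (column P i != fset0).
    have h := component_run _ _ _ _ (col_at_wf _ tN) (fun x => layout_in _ x tN).
    case e : (col_at t) => [p [[a g] b]].
    have sub : components (column P (i0 + t%:Z)) `<=`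
        [fset run (i0 + t%:Z) p a; run (i0 + t%:Z) (p + (a + g)%N%:Z) b].
      apply/fsubsetP => K /h[q [n [+ ->]]]; rewrite e /= in_fset2.
      by case=> [[-> ->]|[_ -> ->]]; rewrite eqxx ?orbT.
    by apply: leq_trans (fsubset_leq_card sub) _; rewrite cardfs2; case: (_ != _).
  rewrite negbK => /eqP ->; rewrite (_ : components fset0 = fset0) ?cardfs0 //.
  apply/fsetP => K; rewrite in_fset0; apply/negP => /mem_components[K0 + _ _].
  by rewrite fsubset0 (negPf K0).
move=> i K L cK cL KL.
have : is_column_index P i.
  have [/fset0Pn[c cinK] /fsubsetP KA _ _] := (mem_components _ _).1 cK.
  by apply/fset0Pn; exists c; exact: KA.
case/layout_index => t tN ei; subst i.
have h := component_run _ _ _ _ (col_at_wf _ tN) (fun x => layout_in _ x tN).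
move: cK cL => /h[q [n [+ eK]]] /h[q' [n' [+ eL]]]; subst K L.
have := col_at_wf _ tN; case e : (col_at t) => [p [[a g] b]].
rewrite /wf /wf_shape /= => wD.
have a0 : (0 < a)%N by case/andP: wD.
have gap3 : (0 < b)%N -> (gap (i0 + t%:Z) (run (i0 + t%:Z) p a)
    (run (i0 + t%:Z) (p + (a + g)%N%:Z) b) #<= `I_3)%card.
  move=> b0; rewrite gapE //; last by clear; lia.
  have -> : p + (a + g)%N%:Z = p + a%:Z + g%:Z by clear; lia.
  by rewrite card_gap; move: wD; clear; lia.
case=> [[e1 e2]|[b0 e1 e2]] [[e3 e4]|[b0' e3 e4]]; subst q n q' n'.
- by rewrite eqxx in KL.
- exact: gap3.
- by rewrite gapC; exact: gap3.
- by rewrite eqxx in KL.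
Qed.

End LayoutCheesy.

Section CheesyLayout.
Variable P : {fset cell}.
Hypothesis cP : cheesy 3 P.

Lemma cheesy_rows i : is_column_index P i ->
  exists D : col, wf D.2 /\ forall x, ((i, x) \in P) = rows D x.
Proof.
case: cP => _ _ card2 gap3 iP.
have [D [wD hD]] := cheesy_column i _ (column_in_stack P i) iP (card2 i) (gap3 i).
by exists D; split => // x; rewrite -hD in_column eqxx.
Qed.

Lemma index_bounded : exists M : nat, forall i, is_column_index P i -> (`|i| <= M)%N.
Proof.
exists (\max_(c <- enum_fset P) `|c.1|%N) => i /fset0Pn[[j x]].
rewrite in_column => /andP[_ iP].
exact: (leq_bigmax_seq (F := fun c : cell => `|c.1|%N) (i, x)).
Qed.

Lemma first_index : exists i, first_column P i.
Proof.
have [M hM] := index_bounded.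
have [[/fset0Pn[[i x] iP] _] _ _ _] := cP.
pose Q (t : nat) := column P (- M%:Z + t%:Z) != fset0.
have exQ : exists t, Q t.
  have ii : is_column_index P i by apply/fset0Pn; exists (i, x); rewrite in_column eqxx.
  exists `|(i + M%:Z)%R|%N; rewrite /Q.
  by have -> : - M%:Z + `|(i + M%:Z)%R|%N%:Z = i by have := hM _ ii; clear; lia.
case: (ex_minnP exQ) => t Qt tmin; exists (- M%:Z + t%:Z); split=> // k kP.
have kM := hM _ kP.
have : Q `|(k + M%:Z)%R|%N.
  by rewrite /Q; have -> : - M%:Z + `|(k + M%:Z)%R|%N%:Z = k by clear -kM; lia.
by move/tmin; clear -kM; lia.
Qed.

(** Cells that share an edge lie in the same stack or in neighbouring ones, and the right column has
    a component touching the left one. *)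
Lemma adjacent_succ i k : adjacent_columns P i k -> k = i + 1.
Proof.
move=> ik; have [_ kP ltik _] := ik.
have [D [wD hD]] := cheesy_rows _ kP.
have rD : exists q n, is_run D q n.
  by have /rowsP[q [n [rn _]]] := rows_low _ wD; exists q, n.
case: rD => q [n rn]; case: cP => _ [_ touch] _ _.
have [|c [d [cR dP cd]]] := touch i k ik (run k q n).
  by apply/(component_run _ _ _ _ wD hD); exists q, n.
move: cR dP cd; case: c d => [c1 c2] [d1 d2].
rewrite in_run in_column share_edgeE /= => /andP[/eqP -> _] /andP[/eqP -> _].
by move: ltik; clear; lia.
Qed.

Lemma contiguous_indices i0 : first_column P i0 ->
  exists N, forall i, is_column_index P i <-> exists2 t, (t <= N)%N & i = i0 + t%:Z.
Proof.
move=> [i0P i0min]; have [M hM] := index_bounded.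
pose Q (t : nat) := column P (i0 + t.+1%:Z) == fset0.
have exQ : exists t, Q t.
  exists (`|i0|%N + M)%N; apply/negPn/negP => /hM; clear; lia.
case: (ex_minnP exQ) => N QN Nmin; exists N => i.
have upto t : (t <= N)%N -> is_column_index P (i0 + t%:Z).
  case: t => [|t] tN; first by rewrite addr0.
  by apply: contraTN tN => /Nmin; rewrite -leqNgt.
split; last by case=> t tN ->; exact: upto.
move=> iP; have ii := i0min _ iP.
have [tN|Nt] := leqP `|(i - i0)%R|%N N.
  by exists `|(i - i0)%R|%N => //; clear -ii; lia.
(* N is the last index before the first empty stack. The first nonempty stack beyond it would be an
   adjacent column of N at distance greater than one. *)
pose Q' (t : nat) := column P (i0 + (N + t)%N.+1%:Z) != fset0.
have exQ' : exists t, Q' t.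
  exists (`|(i - i0)%R|%N - N.+1)%N; rewrite /Q'.
  have -> : i0 + (N + (`|(i - i0)%R|%N - N.+1))%N.+1%:Z = i by clear -ii Nt; lia.
  by [].
case: (ex_minnP exQ') => s Qs smin.
have s0 : s != 0%N by apply/eqP => e; move: Qs; rewrite /Q' e addn0 (eqP QN) eqxx.
suff : i0 + (N + s)%N.+1%:Z = i0 + N%:Z + 1 by clear -s0; lia.
apply: adjacent_succ; split=> //; [exact: upto|by clear; lia|].
move=> j jP; apply/negP => hj.
have : Q' (`|(j - i0)%R|%N - N.+1)%N.
  rewrite /Q'.
  have -> : i0 + (N + (`|(j - i0)%R|%N - N.+1))%N.+1%:Z = j by clear -hj; lia.
  by [].
by move/smin; clear -hj s0; lia.
Qed.

Lemma cheesy_layout : exists i0 C l, [/\ layout P i0 (C :: l),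
  all (fun D => wf D.2) (C :: l), path link C l & C.2.1.2 = 0%N].
Proof.
have [i0 fi0] := first_index.
have [N hN] := contiguous_indices _ fi0.
have idx t : (t <= N)%N -> is_column_index P (i0 + t%:Z) by move=> tN; apply/hN; exists t.
(* Beyond N the choice function takes the dummy value [col0]. *)
have /choice[f hf] : forall t, exists D : col, (t <= N)%N ->
    wf D.2 /\ forall x, ((i0 + t%:Z, x) \in P) = rows D x.
  move=> t; have [tN|Nt] := leqP t N; last by exists col0.
  by have [D hD] := cheesy_rows _ (idx _ tN); exists D.
exists i0, (f 0%N), [seq f t | t <- iota 1 N].
have fE : f 0%N :: [seq f t | t <- iota 1 N] = [seq f t | t <- iota 0 N.+1] by [].
have nthf t : (t <= N)%N -> nth col0 [seq f t | t <- iota 0 N.+1] t = f t.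
  by move=> tN; rewrite (nth_map 0%N) ?size_iota // nth_iota.
split.
- rewrite fE => j x; rewrite size_map size_iota.
  apply/idP/andP => [jP|[jN]].
    have /hN[t tN ej] : is_column_index P j.
      by apply/fset0Pn; exists (j, x); rewrite in_column eqxx.
    subst j; have -> : `|(i0 + t%:Z - i0)%R|%N = t by clear; lia.
    rewrite nthf // -(hf _ tN).2; split => //; clear -tN; lia.
  have tN : (`|(j - i0)%R| <= N)%N by clear -jN; lia.
  rewrite nthf // -(hf _ tN).2.
  by have -> : i0 + `|(j - i0)%R|%N%:Z = j by clear -jN; lia.
- rewrite fE; apply/allP => D /mapP[t + ->]; rewrite mem_iota => tN.
  by have [] := hf t tN.
- apply/(pathP col0) => t; rewrite size_map size_iota => tN.
  rewrite fE nthf ?(ltnW tN) // (nth_map 0%N) ?size_iota // nth_iota // add1n.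
  have [wt ht] := hf _ (ltnW tN); have [wt1 ht1] := hf _ tN.
  apply/(linkP _ _ wt wt1) => q n rn.
  case: cP => _ [_ touch] _ _.
  have adj : adjacent_columns P (i0 + t%:Z) (i0 + t.+1%:Z).
    split; [exact: idx (ltnW tN)|exact: idx|by clear; lia|].
    by move=> j _; clear; lia.
  have [|c [d [cR dP cd]]] := touch _ _ adj (run (i0 + t.+1%:Z) q n).
    by apply/(component_run _ _ _ _ wt1 ht1); exists q, n.
  move: cR dP cd; case: c d => [c1 x] [d1 y].
  rewrite in_run in_column share_edgeE /= ht => /andP[/eqP -> hx] /andP[/eqP -> hy].
  by move=> e; exists x, y; split=> //; move: e; clear; lia.
case: cP => _ [/(_ _ fi0) conn _] _ _.
have [w0 h0] := hf 0%N isT; rewrite addr0 in h0.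
move: w0 h0; case: (f 0%N) => [p [[a g] b]]; rewrite /wf /wf_shape /= => wC h0.
(* If the first column had a gap, convexity would put the lowest cell of the gap into the column. *)
have [//|g0] := eqVneq g 0%N.
have inC x : (i0, x) \in column P i0 = rows (p, (a, g, b)) x.
  by rewrite in_column eqxx h0.
have : (i0, p + a%:Z) \in column P i0.
  apply: (connected_convex i0 _ p (p + (a + g)%N%:Z)) => //.
  - exact: column_in_stack.
  - by rewrite inC /=; move: wC g0; clear; lia.
  - by rewrite inC /=; move: wC g0; clear; lia.
  - by clear; lia.
by rewrite inC /=; move: wC g0; clear; lia.
Qed.

End CheesyLayout.

(** * Uniqueness of codes and translations *)

Lemma rows_inj C D : wf C.2 -> wf D.2 -> rows C =1 rows D -> C = D.
Proof.
case: C D => [p [[a g] b]] [q [[c h] d]]; rewrite /wf /wf_shape /= => wC wD e.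
have a0 : (0 < a)%N by case/andP: wC.
have c0 : (0 < c)%N by case/andP: wD.
(* Testing the rows at the ends of the runs identifies p, a, g and b in turn. *)
have epq : p = q.
  by have := e p; have := e q; rewrite /=; clear -a0 c0; lia.
subst q.
have eac : a = c.
  have := e (p + a%:Z); have := e (p + c%:Z).
  by move: wC wD; rewrite /=; clear; lia.
subst c.
have [g0|g0] := eqVneq g 0%N; have [h0|h0] := eqVneq h 0%N.
- by move: wC wD; rewrite g0 h0 => wC wD; congr (_, (_, _, _)); move: wC wD; clear; lia.
- have := e (p + (a + h)%N%:Z); rewrite /=; move: wC wD; clear -g0 h0; lia.
- have := e (p + (a + g)%N%:Z); rewrite /=; move: wC wD; clear -g0 h0; lia.
have b0 : (0 < b)%N by move: wC; clear -g0; lia.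
have d0 : (0 < d)%N by move: wD; clear -h0; lia.
have egh : g = h.
  have := e (p + (a + g)%N%:Z); have := e (p + (a + h)%N%:Z).
  by rewrite /=; clear -b0 d0 g0 h0; lia.
subst h.
have -> : b = d.
  have := e (p + (a + g + b)%N%:Z); have := e (p + (a + g + d)%N%:Z).
  by rewrite /=; clear -b0 d0 g0; lia.
by [].
Qed.

(** The set of nonempty stacks determines the starting index and the number of columns; each column
    is then determined by its rows. *)
Lemma layout_unique P i i' cs cs' : cs != [::] -> cs' != [::] ->
  all (fun D => wf D.2) cs -> all (fun D => wf D.2) cs' ->
  layout P i cs -> layout P i' cs' -> i = i' /\ cs = cs'.
Proof.
move=> n0 n0' w w' hP hP'.
have range ls k j : all (fun D => wf D.2) ls -> layout P k ls ->
    (k <= j < k + (size ls)%:Z) = (column P j != fset0).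
  move=> wl hl; apply/idP/fset0Pn => [kj|[[j' x]]]; last first.
    by rewrite in_column hl => /and3P[_ ->].
  have sj : (`|(j - k)%R| < size ls)%N by clear -kj; lia.
  exists (j, (nth col0 ls `|(j - k)%R|%N).1).
  by rewrite in_column eqxx hl kj rows_low //; exact: (all_nthP col0 wl).
have eq_range j : (i <= j < i + (size cs)%:Z) = (i' <= j < i' + (size cs')%:Z).
  by rewrite (range cs) // (range cs').
have s0 : (0 < size cs)%N by case: (cs) n0.
have s0' : (0 < size cs')%N by case: (cs') n0'.
have ei : i = i' by have := eq_range i; have := eq_range i'; clear -s0 s0'; lia.
subst i'.
have es : size cs = size cs'.
  have := eq_range (i + (size cs)%:Z); have := eq_range (i + (size cs')%:Z).
  by clear -s0 s0'; lia.
split=> //; apply: (@eq_from_nth _ col0) => // t ts.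
have {}ts : (t < size cs)%N := ts; have ts' : (t < size cs')%N by rewrite -es.
apply: rows_inj; [exact: (all_nthP col0 w)|exact: (all_nthP col0 w')|] => x.
have := hP (i + t%:Z) x; rewrite hP' -es.
have -> : i <= i + t%:Z < i + (size cs)%:Z by clear -ts; lia.
by have -> : `|(i + t%:Z - i)%R|%N = t by clear; lia.
Qed.

Definition shift (y : int) (cs : seq col) : seq col :=
  [seq (D.1 + y, D.2) | D <- cs].

Lemma rows_shift y D x : rows (D.1 + y, D.2) x = rows D (x - y).
Proof. by case: D => [p [[a g] b]] /=; lia. Qed.

Lemma link_shift y C D : link (C.1 + y, C.2) (D.1 + y, D.2) = link C D.
Proof.
by case: C D => [p [[a g] b]] [q [[c h] d]] /=; rewrite /link /meets; lia.
Qed.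

Lemma in_translate v P j x : ((j, x) \in translate v P) = ((j - v.1, x - v.2) \in P).
Proof.
apply/imfsetP/idP => [[[k y] /= kP [-> ->]]|jP]; first by rewrite !addrK.
by exists (j - v.1, x - v.2); rewrite //= !subrK.
Qed.

Lemma layout_translate P i cs v : layout P i cs ->
  layout (translate v P) (i + v.1) (shift v.2 cs).
Proof.
move=> hP j x; rewrite in_translate hP size_map.
have -> : (i <= j - v.1 < i + (size cs)%:Z) = (i + v.1 <= j < i + v.1 + (size cs)%:Z).
  by clear; lia.
have -> : j - v.1 - i = j - (i + v.1) by clear; lia.
have [ij/=|//] := boolP (i + v.1 <= j < i + v.1 + (size cs)%:Z).
rewrite (nth_map col0) ?rows_shift //; clear -ij; lia.
Qed.

Fixpoint cells (i : int) (cs : seq col) : seq cell :=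
  if cs is C :: cs then
    [seq (i, C.1 + t%:Z) | t <- iota 0 C.2.1.1 ++ iota (C.2.1.1 + C.2.1.2) C.2.2]
    ++ cells (i + 1) cs
  else [::].

Lemma mem_cells i cs j x : ((j, x) \in cells i cs) =
  (i <= j < i + (size cs)%:Z) && rows (nth col0 cs `|(j - i)%R|) x.
Proof.
elim: cs i => [|[p [[a g] b]] cs IH] i.
  have -> // : i <= j < i + (size ([::] : seq col))%:Z = false.
  by rewrite /=; clear; lia.
rewrite mem_cat IH.
have -> : ((j, x) \in [seq (i, p + t%:Z) | t <- iota 0 a ++ iota (a + g) b]) =
    (j == i) && rows (p, (a, g, b)) x.
  apply/mapP/andP => [[t + [-> ->]]|[/eqP -> hx]].
    by rewrite mem_cat !mem_iota eqxx /=; clear; lia.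
  exists `|(x - p)%R|%N; last by congr pair; move: hx => /=; clear; lia.
  by rewrite mem_cat !mem_iota; move: hx => /=; clear; lia.
have [->|ji] := eqVneq j i.
  have -> : i + 1 <= i < i + 1 + (size cs)%:Z = false by clear; lia.
  have -> : i <= i < i + (size (((p, (a, g, b)) : col) :: cs))%:Z by rewrite /=; clear; lia.
  by rewrite subrr orbF.
rewrite orFb.
have [ij|ij] := boolP (i + 1 <= j < i + 1 + (size cs)%:Z).
  have -> : i <= j < i + (size (((p, (a, g, b)) : col) :: cs))%:Z.
    by rewrite /=; clear -ij; lia.
  by have -> : `|(j - i)%R|%N = `|(j - (i + 1))%R|.+1 by clear -ij; lia.
have -> // : i <= j < i + (size (((p, (a, g, b)) : col) :: cs))%:Z = false.
by apply/negbTE; move: ij; rewrite /=; clear -ji; lia.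
Qed.

Lemma size_cells i cs : size (cells i cs) = total_area cs.
Proof.
elim: cs i => //= C cs IH i.
by rewrite size_cat size_map size_cat !size_iota IH.
Qed.

Lemma uniq_cells i cs : uniq (cells i cs).
Proof.
elim: cs i => //= C cs IH i; rewrite cat_uniq IH andbT; apply/andP; split.
  rewrite map_inj_uniq => [|s t []]; last by clear; lia.
  rewrite cat_uniq !iota_uniq andbT; apply/hasPn => t; rewrite !mem_iota.
  by clear; lia.
apply/hasPn => -[j x]; rewrite mem_cells => /andP[ij _].
by apply/negP => /mapP[t _ [e _]]; move: ij; rewrite e; clear; lia.
Qed.

Definition decode (i : int) (cs : seq col) : {fset cell} :=
  [fset c in cells i cs].

Lemma layout_decode i cs : layout (decode i cs) i cs.
Proof. by move=> j x; rewrite /decode in_fset_ -mem_cells. Qed.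

Lemma card_decode i cs : #|` decode i cs| = total_area cs.
Proof. by rewrite card_fseq undup_id ?uniq_cells // size_cells. Qed.

Lemma layout_decodeE P i cs : layout P i cs -> P = decode i cs.
Proof.
by move=> hP; apply/fsetP => -[j x]; rewrite hP layout_decode.
Qed.

Lemma translate_comp v w P :
  translate v (translate w P) = translate (v.1 + w.1, v.2 + w.2) P.
Proof.
by apply/fsetP => -[j x]; rewrite !in_translate /= !opprD !addrA.
Qed.

Lemma translate0 P : translate (0, 0) P = P.
Proof. by apply/fsetP => -[j x]; rewrite in_translate !subr0. Qed.

Lemma translation_class_translate v P :
  translation_class (translate v P) = translation_class P.
Proof.
apply/seteqP; split => Q [w ->]; rewrite /translation_class /=.
  by rewrite translate_comp; exists (w.1 + v.1, w.2 + v.2).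
exists (w.1 - v.1, w.2 - v.2); rewrite translate_comp /= !subrK.
by case: w.
Qed.

Lemma total_area_shift y cs : total_area (shift y cs) = total_area cs.
Proof. by rewrite /total_area /shift -map_comp. Qed.

Lemma wf_shift y cs :
  all (fun D : col => wf D.2) (shift y cs) = all (fun D : col => wf D.2) cs.
Proof. by rewrite all_map. Qed.

Lemma shift_codes y n C l : all (fun D => wf D.2) (C :: l) -> path link C l ->
  C.2.1.2 = 0%N -> C.1 + y = 0 -> total_area (C :: l) = n ->
  shift y (C :: l) \in codes n.
Proof.
move=> w lk g0 y0 an; have := mem_codes n (shift y (C :: l)).
rewrite {2}/shift /= => ->; rewrite y0 g0 !eqxx /=.
rewrite -[wf _ && _]/(all (fun D : col => wf D.2) (shift y (C :: l))).
rewrite -[total_area _]/(total_area (shift y (C :: l))).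
rewrite wf_shift w total_area_shift an eqxx andbT /=.
pose h (D : col) : col := (D.1 + y, D.2).
rewrite -y0 -[path _ _ _]/(path link (h C) (map h l)) path_map.
apply: sub_path lk => D E; rewrite -(link_shift y); exact.
Qed.

(** Displaying the classes as a finite set gives [fset_set] its intended value in [cheesy_count]. *)
Lemma cheesy_classesE n : cheesy_classes 3 n =
  [set` [fset S in [seq translation_class (decode 0 cs) | cs <- codes n]]%fset]%classic.
Proof.
apply/seteqP; split => [_ [P [cP <-] <-]|S]; rewrite /= in_fset_.
  have [i [C [l [hP w lk g0]]]] := cheesy_layout _ cP.
  apply/mapP; exists (shift (- C.1) (C :: l)).
    apply: shift_codes => //; first by rewrite subrr.
    by rewrite -(card_decode i) -(layout_decodeE _ _ _ hP).
  have := layout_translate _ _ _ (- i, - C.1) hP; rewrite /= subrr.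
  by move/layout_decodeE => <-; rewrite translation_class_translate.
case/mapP => cs + ->; rewrite mem_codes; case: cs => // C l.
case/and5P => _ /eqP g0 w lk /eqP an.
exists (decode 0 (C :: l)) => //; split; last by rewrite /= card_decode an.
exact: layout_cheesy (layout_decode 0 (C :: l)) w lk g0.
Qed.

(** Both codes start at row 0, so by uniqueness of layouts the translation between them has no
    vertical component. *)
Lemma translation_class_inj n :
  {in codes n &, injective (fun cs => translation_class (decode 0 cs))}.
Proof.
move=> cs cs'; rewrite !mem_codes; case: cs cs' => // C l [//|C' l'].
case/and5P => /eqP C0 _ w _ _ /and5P[/eqP C0' _ w' _ _] e.
have : translation_class (decode 0 (C :: l)) (decode 0 (C :: l)).
  by exists (0, 0); rewrite translate0.
rewrite e => -[v ev].
have h := layout_translate _ _ _ v (layout_decode 0 (C' :: l')).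
rewrite -ev in h.
have ws : all (fun D => wf D.2) (shift v.2 (C' :: l')) by rewrite wf_shift.
have [_ ecs] := layout_unique _ _ _ (C :: l) (shift v.2 (C' :: l')) isT isT w ws
  (layout_decode 0 (C :: l)) h.
have v0 : v.2 = 0 by case: ecs => eC _; move: C0; rewrite eC /= C0' add0r.
rewrite ecs v0 /shift; apply: map_id_in => -[p s] _.
by rewrite /= addr0.
Qed.

Lemma cheesy_count_codes n : cheesy_count 3 n = size (codes n).
Proof.
rewrite /cheesy_count cheesy_classesE set_fsetK card_fseq undup_id ?size_map //.
rewrite map_inj_in_uniq; first exact: uniq_codes.
exact: translation_class_inj.
Qed.

Theorem corollary4 (R : realType) :
  exists kappa lambda : R,
    [/\ 108269%:R / 10 ^+ 6 <= kappa < 108270%:R / 10 ^+ 6,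
        4288630%:R / 10 ^+ 6 <= lambda < 4288631%:R / 10 ^+ 6 &
        (cheesy_count 3 n)%:R / (kappa * lambda ^+ n) @[n --> \oo] --> (1 : R)].
Proof.
have [kappa [lambda [hk hl cvg]]] := recurrence_asymptotics T_count T_count_rec R.
exists kappa, lambda; split=> //.
suff -> : (fun n => (cheesy_count 3 n)%:R / (kappa * lambda ^+ n)) =
    (fun n => zr R (sX T_count 0 n) / (kappa * lambda ^+ n)) by [].
by apply/funext => n; rewrite cheesy_count_codes -size_codes zr_nat.
Qed.
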